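(* Let $\mathfrak{g}=\mathfrak{sl}(2,\mathbb{C})\oplus\mathfrak{n}_3$ be the six-dimensional complex Lie algebra, semidirect product of $\mathfrak{sl}(2,\mathbb{C})$ (basis $h,e,f$) by the Heisenberg algebra $\mathfrak{n}_3$ (basis $p,q,z$), with brackets $$[h,e]=2e,\ [h,f]=-2f,\ [e,f]=h,\ [q,p]=z,\ [h,q]=q,\ [h,p]=-p,\ [e,p]=q,\ [f,q]=p,$$ all other brackets of basis elements being zero or deduced by antisymmetry. Let $P\in\mathcal{S}\mathfrak{g}\otimes\Lambda^2\mathfrak{n}_3^*$ be defined by $P:=C\,q^*\wedge p^*$ with $C:=h^2+4ef$ (the quadratic Casimir element of $\mathcal{S}\mathfrak{sl}(2,\mathbb{C})$), where $p^*,q^*,z^*$ is the basis of $\mathfrak{n}_3^*$ dual to $p,q,z$. Then $P$ is $\mathfrak{sl}(2,\mathbb{C})$-invariant, $[P,P]_s=0=[P_0,P]_s$, and $P$ is not cohomologous to $0$ in $\mathbf{H}^2_{CE}(\mathfrak{n}_3,\mathcal{S}\mathfrak{g})^{\mathfrak{sl}(2,\mathbb{C})}$. In particular, $\mathfrak{g}$ is not strongly rigid.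
   Context: $\mathcal{S}\mathfrak{g}$ is the symmetric algebra, identified with the polynomial functions on $\mathfrak{g}^*$, with $\mathfrak{g}$ acting by the extension of the adjoint action by derivations. Elements of $\mathcal{S}\mathfrak{g}\otimes\Lambda^k\mathfrak{g}^*$ are identified with polynomial $k$-vector fields on $\mathfrak{g}^*$; here $\mathfrak{n}_3^*\subset\mathfrak{g}^*$ via the dual basis of $(h,e,f,p,q,z)$, so that $q^*\wedge p^*$ is the constant bivector field $\partial_q\wedge\partial_p$ and $P$ is a bivector field. $[\cdot,\cdot]_s$ is the Schouten bracket, and $P_0$ is the linear Poisson structure on $\mathfrak{g}^*$: $\{x,y\}=[x,y]$ for $x,y\in\mathfrak{g}$. $\mathbf{H}_{CE}$ denotes Chevalley–Eilenberg cohomology, and the superscript denotes $\mathfrak{sl}(2,\mathbb{C})$-invariants. A formal associative deformation of an associative $\mathbb{C}$-algebra $(\mathcal{A},\mu_0)$ is an associative $\mathbb{C}[[t]]$-bilinear product $\mu_t=\mu_0+t\mu_1+t^2\mu_2+\cdots$ on $\mathcal{A}[[t]]$; it is trivial if there is $\varphi_t=\mathrm{Id}+t\varphi_1+\cdots$ with $\varphi_r\in\mathrm{Hom}(\mathcal{A},\mathcal{A})$ and $\varphi_t(\mu_t(a,b))=\mu_0(\varphi_t(a),\varphi_t(b))$. The algebra $\mathcal{A}$ is rigid if every formal associative deformation is trivial. A Lie algebra $\mathfrak{g}$ is strongly rigid if its universal enveloping algebra $\mathcal{U}\mathfrak{g}$ is rigid as an associative algebra. *)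

(* Defs.v *)
From HB Require Import structures.
From mathcomp Require Import all_boot all_order all_algebra.
From mathcomp Require Import reals complex.
From mathcomp Require Import mpoly.
From mathcomp Require Import ring.

Set Implicit Arguments.
Unset Strict Implicit.
Unset Printing Implicit Defensive.
Import GRing.Theory.
Local Open Scope ring_scope.

HB.mixin Record Lmodule_isLieAlgebra (K : fieldType) L
    & GRing.Lmodule K L := {
  lie : L -> L -> L;
  lie_linearl : forall a x y w, lie (a *: x + y) w = a *: lie x w + lie y w;
  lie_linearr : forall a w x y, lie w (a *: x + y) = a *: lie w x + lie w y;
  liexx : forall x, lie x x = 0;
  lie_jacobi : forall x y w,
    lie x (lie y w) + lie y (lie w x) + lie w (lie x y) = 0
}.

#[short(type="lieAlgType")]
HB.structure Definition LieAlgebra (K : fieldType) :=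
  {L of Lmodule_isLieAlgebra K L & GRing.Lmodule K L}.

Lemma lie0r (K : fieldType) (L : lieAlgType K) (x : L) : lie x 0 = 0.
Proof.
by have := lie_linearr (-1) x 0 0; rewrite scaler0 addr0 scaleN1r addNr.
Qed.

Lemma lieN (K : fieldType) (L : lieAlgType K) (x y : L) : lie y x = - lie x y.
Proof.
apply/eqP; rewrite -addr_eq0.
have lieDl (u v w : L) : lie (u + v) w = lie u w + lie v w.
  by have := lie_linearl 1 u v w; rewrite !scale1r.
have lieDr (u v w : L) : lie w (u + v) = lie w u + lie w v.
  by have := lie_linearr 1 w u v; rewrite !scale1r.
have := liexx (x + y).
by rewrite lieDl !lieDr !liexx add0r addr0 addrC => ->.
Qed.

Lemma lieNr (K : fieldType) (L : lieAlgType K) (x y : L) :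
  lie x (- y) = - lie x y.
Proof.
by have := lie_linearr (-1) x y 0; rewrite !scaleN1r lie0r !addr0.
Qed.

Definition lie_action (K : fieldType) (L : lieAlgType K) (M : lmodType K)
    (act : L -> M -> M) : Prop :=
  [/\ forall m, linear (act^~ m),
      forall x, linear (act x)
    & forall x y m, act (lie x y) m = act x (act y m) - act y (act x m)].

(* The Chevalley-Eilenberg complex C^1(L, M) -> C^2(L, M) -> C^3(L, M), where
   k-cochains are the alternating k-linear maps and L acts on M through act. *)
Section ChevalleyEilenberg.
Variables (K : fieldType) (L : lieAlgType K) (M : lmodType K).
Variable act : L -> M -> M.

Definition ce_cochain2 (c : L -> L -> M) : Prop :=
  [/\ forall y, linear (c^~ y), forall x, linear (c x) & forall x, c x x = 0].

Definition ce_d1 (phi : L -> M) (x y : L) : M :=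
  act x (phi y) - act y (phi x) - phi (lie x y).

Definition ce_d2 (c : L -> L -> M) (x y w : L) : M :=
  act x (c y w) - act y (c x w) + act w (c x y)
  - c (lie x y) w + c (lie x w) y - c (lie y w) x.

Definition ce_cocycle2 (c : L -> L -> M) : Prop :=
  ce_cochain2 c /\ forall x y w, ce_d2 c x y w = 0.

Definition ce_coboundary2 (c : L -> L -> M) : Prop :=
  exists phi : {linear L -> M}, forall x y, c x y = ce_d1 phi x y.

Definition ce_cohomologous2 (c c' : L -> L -> M) : Prop :=
  ce_coboundary2 (fun x y => c x y - c' x y).

End ChevalleyEilenberg.

(* A[[t]] is represented by the sequences of coefficients nat -> A. *)
Section FormalDeformations.
Variables (K : fieldType) (A : algType K).

Definition fps_bilin (mu : nat -> A -> A -> A) (a b : nat -> A) : nat -> A :=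
  fun n => \sum_(i < n.+1) \sum_(j < (n - i).+1) mu (n - i - j)%N (a i) (b j).

Definition fps_lin (phi : nat -> A -> A) (a : nat -> A) : nat -> A :=
  fun n => \sum_(i < n.+1) phi (n - i)%N (a i).

Definition fps_mul (a b : nat -> A) : nat -> A :=
  fun n => \sum_(i < n.+1) a i * b (n - i)%N.

(* The C[[t]]-bilinear products on A[[t]] are the fps_bilin mu with every mu r
   bilinear over K. *)
Definition formal_deformation (mu : nat -> A -> A -> A) : Prop :=
  [/\ forall r b, linear ((mu r)^~ b),
      forall r a, linear (mu r a),
      forall a b, mu 0%N a b = a * b
    & forall a b c, fps_bilin mu (fps_bilin mu a b) c
                    =1 fps_bilin mu a (fps_bilin mu b c)].

Definition trivial_deformation (mu : nat -> A -> A -> A) : Prop :=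
  exists phi : nat -> {linear A -> A},
    (forall a, phi 0%N a = a) /\
    forall a b, fps_lin phi (fps_bilin mu a b)
                =1 fps_mul (fps_lin phi a) (fps_lin phi b).

Definition rigid : Prop :=
  forall mu, formal_deformation mu -> trivial_deformation mu.

End FormalDeformations.

Definition lie_to_assoc (K : fieldType) (L : lieAlgType K) (A : algType K)
    (f : L -> A) : Prop :=
  forall x y, f (lie x y) = f x * f y - f y * f x.

Definition universal_enveloping (K : fieldType) (L : lieAlgType K)
    (U : algType K) (iota : {linear L -> U}) : Prop :=
  lie_to_assoc iota /\
  forall (A : algType K) (f : {linear L -> A}), lie_to_assoc f ->
    exists F : {lrmorphism U -> A},
      (forall x, F (iota x) = f x) /\
      forall G : {lrmorphism U -> A}, (forall x, G (iota x) = f x) -> G =1 F.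

(* Enveloping algebras are unique up to isomorphism, and the negation of this
   statement entails that one exists. *)
Definition strongly_rigid (K : fieldType) (L : lieAlgType K) : Prop :=
  forall (U : algType K) (iota : {linear L -> U}),
    universal_enveloping iota -> rigid U.

Definition ih : 'I_6 := @Ordinal 6 0 isT.
Definition ie : 'I_6 := @Ordinal 6 1 isT.
Definition if_ : 'I_6 := @Ordinal 6 2 isT.
Definition ip : 'I_6 := @Ordinal 6 3 isT.
Definition iq : 'I_6 := @Ordinal 6 4 isT.
Definition iz : 'I_6 := @Ordinal 6 5 isT.

Definition sl2n3 (K : fieldType) : Type := 'rV[K]_6.
HB.instance Definition _ (K : fieldType) := Vector.on (sl2n3 K).

Section Sl2Heisenberg.
Variable K : fieldType.
Local Notation g := (sl2n3 K).

Definition coordg (i : 'I_6) (x : g) : K := (x : 'rV[K]_6) 0 i.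
Definition basisg (i : 'I_6) : g := (delta_mx 0 i : 'rV[K]_6).

Definition bracket_table : seq ('I_6 * 'I_6 * g) :=
  [:: (ih, ie, 2%:R *: basisg ie); (ih, if_, - 2%:R *: basisg if_);
      (ie, if_, basisg ih);        (iq, ip, basisg iz);
      (ih, iq, basisg iq);         (ih, ip, - basisg ip);
      (ie, ip, basisg iq);         (if_, iq, basisg ip)].

Definition bracketg (x y : g) : g :=
  \sum_(t <- bracket_table)
    (coordg t.1.1 x * coordg t.1.2 y - coordg t.1.2 x * coordg t.1.1 y) *: t.2.

Lemma coordg_linear i : scalar (coordg i).
Proof. by move=> a x y; rewrite /coordg !mxE. Qed.

Lemma coordg_basis i j : coordg i (basisg j) = (i == j)%:R.
Proof. by rewrite /coordg /basisg mxE. Qed.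

HB.instance Definition _ i :=
  GRing.isLinear.Build K g K *%R (coordg i) (coordg_linear i).

Lemma coordgP (x y : g) : (forall i, coordg i x = coordg i y) -> x = y.
Proof. by move=> e; apply/rowP => i; exact: e. Qed.

Lemma coordgE (x y : g) :
  (coordg ih (bracketg x y)
    = coordg ie x * coordg if_ y - coordg if_ x * coordg ie y) *
  (coordg ie (bracketg x y)
    = 2%:R * (coordg ih x * coordg ie y - coordg ie x * coordg ih y)) *
  (coordg if_ (bracketg x y)
    = - 2%:R * (coordg ih x * coordg if_ y - coordg if_ x * coordg ih y)) *
  (coordg ip (bracketg x y)
    = - (coordg ih x * coordg ip y - coordg ip x * coordg ih y)
      + (coordg if_ x * coordg iq y - coordg iq x * coordg if_ y)) *
  (coordg iq (bracketg x y)
    = (coordg ih x * coordg iq y - coordg iq x * coordg ih y)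
      + (coordg ie x * coordg ip y - coordg ip x * coordg ie y)) *
  (coordg iz (bracketg x y)
    = coordg iq x * coordg ip y - coordg ip x * coordg iq y).
Proof.
rewrite /bracketg /bracket_table !big_cons big_nil /=.
do !split; rewrite !(linearD, linearZ, linearN, linear0) /= !coordg_basis /=;
  ring.
Qed.

Lemma ord6P (P : 'I_6 -> Prop) :
  P ih -> P ie -> P if_ -> P ip -> P iq -> P iz -> forall i, P i.
Proof.
move=> P0 P1 P2 P3 P4 P5; case=> [[|[|[|[|[|[|//]]]]]]] lti.
- by rewrite (_ : Ordinal lti = ih) //; exact/val_inj.
- by rewrite (_ : Ordinal lti = ie) //; exact/val_inj.
- by rewrite (_ : Ordinal lti = if_) //; exact/val_inj.
- by rewrite (_ : Ordinal lti = ip) //; exact/val_inj.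
- by rewrite (_ : Ordinal lti = iq) //; exact/val_inj.
- by rewrite (_ : Ordinal lti = iz) //; exact/val_inj.
Qed.

Fact bracketg_linearl a x y w :
  bracketg (a *: x + y) w = a *: bracketg x w + bracketg y w.
Proof.
apply: coordgP; elim/ord6P;
rewrite !(linearD, linearZ) /= !coordgE !(linearD, linearZ) /=; ring.
Qed.

Fact bracketg_linearr a w x y :
  bracketg w (a *: x + y) = a *: bracketg w x + bracketg w y.
Proof.
apply: coordgP; elim/ord6P;
rewrite !(linearD, linearZ) /= !coordgE !(linearD, linearZ) /=; ring.
Qed.

Fact bracketgxx x : bracketg x x = 0.
Proof. by apply: coordgP; elim/ord6P; rewrite !linear0 !coordgE; ring. Qed.

Fact bracketg_jacobi x y w :
  bracketg x (bracketg y w) + bracketg y (bracketg w x)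
  + bracketg w (bracketg x y) = 0.
Proof.
by apply: coordgP; elim/ord6P; rewrite !linearD linear0 /= !coordgE; ring.
Qed.

HB.instance Definition _ := Lmodule_isLieAlgebra.Build K (sl2n3 K)
  bracketg_linearl bracketg_linearr bracketgxx bracketg_jacobi.

Definition sl2 : {vspace g} := <<[:: basisg ih; basisg ie; basisg if_]>>%VS.
Definition n3_vspace : {vspace g} :=
  <<[:: basisg ip; basisg iq; basisg iz]>>%VS.

Lemma mem_n3P x : reflect
  [/\ coordg ih x = 0, coordg ie x = 0 & coordg if_ x = 0] (x \in n3_vspace).
Proof.
apply: (iffP idP) => [|[x0 x1 x2]].
  rewrite /n3_vspace !span_cons span_nil addv0.
  case/memv_addP => _ /vlineP[a ->] [_ /memv_addP[_ /vlineP[b ->]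
    [_ /vlineP[c ->] ->]] ->].
  by split; rewrite !(linearD, linearZ) /= !coordg_basis /=; ring.
have -> : x = coordg ip x *: basisg ip + coordg iq x *: basisg iq
              + coordg iz x *: basisg iz.
  apply: coordgP; elim/ord6P;
  rewrite !(linearD, linearZ) /= !coordg_basis /= ?(x0, x1, x2); ring.
by rewrite !memvD // memvZ // memv_span // !inE eqxx ?orbT.
Qed.

Lemma n3_ideal (x u : g) : u \in n3_vspace -> lie x u \in n3_vspace.
Proof.
by case/mem_n3P => u0 u1 u2; apply/mem_n3P; split;
  rewrite /lie /= !coordgE ?(u0, u1, u2); ring.
Qed.

End Sl2Heisenberg.

Definition n3 (K : fieldType) : Type := subvs_of (n3_vspace K).
HB.instance Definition _ (K : fieldType) := Vector.on (n3 K).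

Section PolyvectorFields.
Variable K : fieldType.
Local Notation g := (sl2n3 K).

Definition n3_incl (u : n3 K) : g := vsval u.

(* vsproj is used only on vectors of n3_vspace, which is an ideal of g. *)
Definition ad_n3 (x : g) (u : n3 K) : n3 K :=
  vsproj (n3_vspace K) (lie x (n3_incl u)).

Definition bracket_n3 (u v : n3 K) : n3 K := ad_n3 (n3_incl u) v.

Lemma ad_n3E x u : n3_incl (ad_n3 x u) = lie x (n3_incl u).
Proof. by rewrite /n3_incl /ad_n3 vsprojK // n3_ideal // subvsP. Qed.

Lemma bracket_n3E u v :
  n3_incl (bracket_n3 u v) = lie (n3_incl u) (n3_incl v).
Proof. exact: ad_n3E. Qed.

Fact n3_incl_linear : linear n3_incl.
Proof. exact: linearP. Qed.

HB.instance Definition _ :=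
  GRing.isLinear.Build K (n3 K) g _ n3_incl n3_incl_linear.

Lemma n3_incl_inj : injective n3_incl.
Proof. exact: subvs_inj. Qed.

Fact n3_inclD u v : n3_incl (u + v) = n3_incl u + n3_incl v.
Proof. exact: linearD. Qed.

Fact n3_incl0 : n3_incl 0 = 0.
Proof. exact: linear0. Qed.

Fact bracket_n3_linearl a (x y w : n3 K) :
  bracket_n3 (a *: x + y) w = a *: bracket_n3 x w + bracket_n3 y w.
Proof.
apply: n3_incl_inj; rewrite bracket_n3E n3_incl_linear lie_linearl.
by rewrite n3_incl_linear !bracket_n3E.
Qed.

Fact bracket_n3_linearr a (w x y : n3 K) :
  bracket_n3 w (a *: x + y) = a *: bracket_n3 w x + bracket_n3 w y.
Proof.
apply: n3_incl_inj; rewrite bracket_n3E n3_incl_linear lie_linearr.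
by rewrite n3_incl_linear !bracket_n3E.
Qed.

Fact bracket_n3xx (x : n3 K) : bracket_n3 x x = 0.
Proof. by apply: n3_incl_inj; rewrite bracket_n3E liexx n3_incl0. Qed.

Fact bracket_n3_jacobi (x y w : n3 K) :
  bracket_n3 x (bracket_n3 y w) + bracket_n3 y (bracket_n3 w x)
  + bracket_n3 w (bracket_n3 x y) = 0.
Proof.
by apply: n3_incl_inj; rewrite !n3_inclD !bracket_n3E lie_jacobi n3_incl0.
Qed.

HB.instance Definition _ := Lmodule_isLieAlgebra.Build K (n3 K)
  bracket_n3_linearl bracket_n3_linearr bracket_n3xx bracket_n3_jacobi.

(* The symmetric algebra of g, in the basis (h, e, f, p, q, z). *)
Local Notation Sg := {mpoly K[6]}.

Definition sym_incl (x : g) : Sg := \sum_i coordg i x *: 'X_i.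

(* The derivation of Sg extending ad x. *)
Definition sym_act (x : g) (F : Sg) : Sg :=
  \sum_i sym_incl (lie x (basisg K i)) * F^`M(i).

Lemma mderiv_sym_incl i x : (sym_incl x)^`M(i) = (coordg i x)%:MP.
Proof.
rewrite /sym_incl linear_sum (bigD1 i) //= linearZ /= mderivX mnmE eqxx.
rewrite big1 => [|j ne_ji]; last first.
  by rewrite linearZ /= mderivX mnmE (negPf ne_ji) scale0r scaler0.
rewrite addr0 (_ : (U_(i) - U_(i))%MM = 0%MM) ?mpolyX0 ?scale1r ?alg_mpolyC //.
by apply/mnmP => j; rewrite mnmBE mnm0E subnn.
Qed.

Lemma sym_incl_linear : linear sym_incl.
Proof.
move=> a x y; rewrite /sym_incl scaler_sumr -big_split /=.
by apply: eq_bigr => i _; rewrite linearP /= scalerDl scalerA.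
Qed.

HB.instance Definition _ :=
  GRing.isLinear.Build K g Sg _ sym_incl sym_incl_linear.

Lemma sum_coordg (x : g) : x = \sum_i coordg i x *: basisg K i.
Proof.
apply: coordgP => j; rewrite linear_sum (bigD1 j) //= linearZ /= coordg_basis.
rewrite eqxx mulr1 big1 ?addr0 // => i ne_ij.
by rewrite linearZ /= coordg_basis eq_sym (negPf ne_ij) mulr0.
Qed.

Lemma sym_act_incl x y : sym_act x (sym_incl y) = sym_incl (lie x y).
Proof.
rewrite /sym_act {2}[y]sum_coordg.
have -> : lie x (\sum_i coordg i y *: basisg K i) =
          \sum_i coordg i y *: lie x (basisg K i).
  elim/big_rec2: _ => [|i u v _ <-]; [exact: lie0r | exact: lie_linearr].
rewrite linear_sum; apply: eq_bigr => i _.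
by rewrite mderiv_sym_incl linearZ /= mulrC mul_mpolyC.
Qed.

Lemma sym_actM x F G :
  sym_act x (F * G) = sym_act x F * G + F * sym_act x G.
Proof.
rewrite /sym_act mulr_suml mulr_sumr -big_split /=; apply: eq_bigr => i _.
by rewrite mderivM; ring.
Qed.

Lemma sym_act_linear x : linear (sym_act x).
Proof.
move=> a F G; rewrite /sym_act scaler_sumr -big_split /=.
by apply: eq_bigr => i _; rewrite linearP /= mulrDr scalerAr.
Qed.

HB.instance Definition _ x :=
  GRing.isLinear.Build K Sg Sg _ (sym_act x) (sym_act_linear x).

Lemma sym_act_lie_action : lie_action sym_act.
Proof.
split; [move=> F a x y | exact: sym_act_linear | move=> x y F].
  rewrite /sym_act scaler_sumr -big_split /=; apply: eq_bigr => i _.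
  by rewrite lie_linearl linearP mulrDl scalerAl.
have act0 u : sym_act u 0 = 0 by exact: linear0.
have actD u F1 F2 : sym_act u (F1 + F2) = sym_act u F1 + sym_act u F2.
  exact: linearD.
have actZ u a F1 : sym_act u (a *: F1) = a *: sym_act u F1 by exact: linearZ.
elim/mpolyind: F => [|a m F _ _ IH]; first by rewrite !act0 subr0.
rewrite !actD !actZ IH opprD addrACA; congr (_ + _).
rewrite -scalerBr; congr (_ *: _).
have act1 u : sym_act u 1 = 0.
  by rewrite /sym_act big1 // => i _; rewrite -mpolyC1 mderivC mulr0.
rewrite mpolyXE_id; elim/big_rec: _ => [|i G _ IHG].
  by rewrite !act1 !act0 subr0.
have actX : sym_act (lie x y) 'X_i
            = sym_act x (sym_act y 'X_i) - sym_act y (sym_act x 'X_i).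
  have -> : 'X_i = sym_incl (basisg K i).
    rewrite /sym_incl (bigD1 i) //= coordg_basis eqxx scale1r big1 ?addr0 //.
    by move=> j ne_ji; rewrite coordg_basis (negPf ne_ji) scale0r.
  rewrite !sym_act_incl -linearB /=; congr sym_incl.
  have := lie_jacobi x y (basisg K i).
  rewrite [lie (basisg K i) x]lieN lieNr [lie (basisg K i) _]lieN.
  by move/eqP; rewrite subr_eq0 => /eqP.
have actXn k : sym_act (lie x y) ('X_i ^+ k)
            = sym_act x (sym_act y ('X_i ^+ k)) - sym_act y (sym_act x ('X_i ^+ k)).
  elim: k => [|k IHk]; first by rewrite expr0 !act1 !act0 subr0.
  by rewrite exprS !sym_actM !actD !sym_actM IHk actX; ring.
by rewrite !sym_actM !actD !sym_actM IHG actXn; ring.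
Qed.

Definition sym_act_n3 (u : n3 K) (F : Sg) : Sg := sym_act (n3_incl u) F.

(* A bivector field on g^*, i.e. an element of Sg (x) Lambda^2 g^*, is an
   alternating bilinear map g -> g -> Sg; biderivation B F G is its value on
   the differentials of the functions F and G. *)
Definition biderivation (B : g -> g -> Sg) (F G : Sg) : Sg :=
  \sum_i \sum_j B (basisg K i) (basisg K j) * F^`M(i) * G^`M(j).

(* The Schouten bracket of two bivector fields, as an alternating trilinear map
   on g, normalized so that schouten2 B B is twice the Jacobiator of B. *)
Definition schouten2 (B B' : g -> g -> Sg) (x y w : g) : Sg :=
  let half (B1 B2 : g -> g -> Sg) :=
    biderivation B1 (B2 x y) (sym_incl w)
    + biderivation B1 (B2 y w) (sym_incl x)
    + biderivation B1 (B2 w x) (sym_incl y) in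
  half B B' + half B' B.

Definition poisson0 (x y : g) : Sg := sym_incl (lie x y).

Definition casimir : Sg :=
  'X_ih ^+ 2 + 4%:R * 'X_ie * 'X_if_.

Definition wedge (u v : g -> K) (x y : g) : K := u x * v y - u y * v x.

(* P = C q^* /\ p^*; n3^* embeds into g^* through the dual basis, so P vanishes
   as soon as one argument lies in sl2. *)
Definition bivP (x y : g) : Sg := wedge (coordg iq) (coordg ip) x y *: casimir.

Definition restr_n3 (B : g -> g -> Sg) (u v : n3 K) : Sg :=
  B (n3_incl u) (n3_incl v).

Definition act_cochain2 (x : g) (c : n3 K -> n3 K -> Sg) (u v : n3 K) : Sg :=
  sym_act x (c u v) - c (ad_n3 x u) v - c u (ad_n3 x v).

Definition sl2_invariant (c : n3 K -> n3 K -> Sg) : Prop :=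
  forall x, x \in sl2 K -> forall u v, act_cochain2 x c u v = 0.

(* The class of c belongs to the sl2-invariants of H^2(n3, Sg). *)
Definition in_H2_invariants (c : n3 K -> n3 K -> Sg) : Prop :=
  ce_cocycle2 sym_act_n3 c /\
  forall x, x \in sl2 K ->
    ce_cohomologous2 sym_act_n3 (act_cochain2 x c) (fun _ _ => 0).

End PolyvectorFields.

Arguments bivP : clear implicits.
Arguments poisson0 : clear implicits.
Arguments sym_act_n3 : clear implicits.

(* Main.v *)
Require Import Defs.
From HB Require Import structures.
From mathcomp Require Import all_boot all_order all_algebra.
From mathcomp Require Import reals complex mpoly ssrcomplements ring.

Set Implicit Arguments.
Unset Strict Implicit.
Unset Printing Implicit Defensive.
Import GRing.Theory.
Local Open Scope ring_scope.

(** [P] is quantized by an infinitesimal Hecke algebra [U_tau] of [sl(2)]: the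
    algebra with the generators and relations of [U g], except that
    [q p - p q = z + tau C]. Over any commutative ring, its ordered monomials
    [p^i f^a q^b e^c h^d z^l] form a basis: the left multiplications by the
    generators are written down on the space spanned by these monomials ([e] and
    [q] by recursion on [i]), and satisfy the relations by induction on [i].
    Hence any module over the relations is acted upon by that space, which
    yields the associative product of [U_tau] and the universal property of
    [U g], the case [tau = 0]. The coefficients in [t] of the product of [U_t]
    over [K[t]] form the deformation [mu_t] of [U g].

    If [mu_t] were trivial, the first order terms [q1, p1, z1] of the
    equivalence would satisfy [C + z1 = [q1, p] + [q, p1]] and [[z1, q] = 0] in
    [U g]. In the affine representation on [K + K^2], all elements are block
    triangular, [p] and [q] strictly so; the diagonal blocks [0] and [3] of [C]
    force those of [z1] to be [0] and [-3], and then [z1] does not commute with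
    [q]. The cohomology class of [P] is nonzero for the same reason: [C + phi z]
    lies in the ideal [(p, q, z)] of [S g] while [q . phi z = 0], which makes
    [d(phi z)/dh] vanish on [p = q = z = 0], unlike [dC/dh = 2 h]. *)

(** * Multivariate polynomials *)

Lemma mderivXU (R : nzRingType) n (i j : 'I_n) :
  ('X_j : {mpoly R[n]})^`M(i) = (i == j)%:R.
Proof.
rewrite mderivX mnm1E eq_sym; case: eqP => [->|_]; last by rewrite scale0r.
by rewrite scale1r -[X in (X - _)%MM]add0m addmK mpolyX0.
Qed.

Lemma mderiv_mulX (R : nzRingType) n (i j : 'I_n) (v : {mpoly R[n]}) :
  ('X_j * v)^`M(i) = v *+ (i == j) + 'X_j * v^`M(i).
Proof. by rewrite mderivM mderivXU mulr_natl. Qed.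

Lemma mderiv1 (R : nzRingType) n (i : 'I_n) : (1 : {mpoly R[n]})^`M(i) = 0.
Proof. by rewrite -mpolyC1 mderivC. Qed.

Lemma mderivX_eq0 (R : nzRingType) n (i : 'I_n) (m : 'X_{1..n}) :
  m i = 0%N -> 'X_[m]^`M(i) = 0 :> {mpoly R[n]}.
Proof. by rewrite mderivX => ->; rewrite scale0r. Qed.

Lemma mderivXD1 (R : nzRingType) n (i : 'I_n) (m : 'X_{1..n}) :
  'X_[U_(i) + m]^`M(i) = 'X_[m] *+ (m i).+1 :> {mpoly R[n]}.
Proof. by rewrite mderivX mnmDE mnm1E eqxx scaler_nat addmC addmK. Qed.

Lemma mulX_mderivX (R : comNzRingType) n (i : 'I_n) (m : 'X_{1..n}) :
  'X_i * 'X_[m]^`M(i) = 'X_[m] *+ m i :> {mpoly R[n]}.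
Proof.
rewrite mderivX -scalerAr -mpolyXD scaler_nat.
case: (posnP (m i)) => [->|mi_gt0]; first by rewrite !mulr0n.
by rewrite addmC submK // lep1mP -lt0n.
Qed.

Lemma mnm_pos_split n (m : 'X_{1..n}) i :
  (0 < m i)%N -> exists m', m = (U_(i) + m')%MM.
Proof.
by move=> mi_gt0; exists (m - U_(i))%MM; rewrite addmC submK // lep1mP -lt0n.
Qed.

Definition mnm_del n (i : 'I_n) (m : 'X_{1..n}) : 'X_{1..n} :=
  [multinom if j == i then 0%N else m j | j < n].

Lemma mnm_del_id n (i : 'I_n) (m : 'X_{1..n}) :
  m i = 0%N -> mnm_del i m = m.
Proof.
by move=> mi0; apply/mnmP => j; rewrite mnmE; case: eqP => // ->; rewrite mi0.
Qed.

Lemma mnm_del_addU n (i : 'I_n) (m : 'X_{1..n}) :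
  mnm_del i (U_(i) + m)%MM = mnm_del i m.
Proof.
apply/mnmP => j; rewrite !mnmE; case: eqP => // /eqP ne_ji.
by rewrite eq_sym (negPf ne_ji).
Qed.

Lemma mpolyX_mnm_del (R : nzRingType) n (i : 'I_n) (m : 'X_{1..n}) :
  'X_i ^+ m i * 'X_[mnm_del i m] = 'X_[m] :> {mpoly R[n]}.
Proof.
rewrite mpolyXn -mpolyXD; congr 'X_[_]; apply/mnmP => j.
rewrite mnmDE mulmnE mnm1E mnmE eq_sym; case: eqP => [->|_].
  by rewrite mul1n addn0.
by rewrite mul0n.
Qed.

Lemma mpoly_linear_ind (R : nzRingType) n (Pr : {mpoly R[n]} -> Prop) :
  (forall a v w, Pr v -> Pr w -> Pr (a *: v + w)) -> Pr 0 ->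
  (forall m, Pr 'X_[m]) -> forall v, Pr v.
Proof. by move=> PD P0 PX; apply: mpolyind => // a m v _ _; apply: PD. Qed.

Section MonomialLift.
Variables (R : nzRingType) (n : nat) (M : lmodType R) (phi : 'X_{1..n} -> M).

Definition mlift (v : {mpoly R[n]}) : M := \sum_(m <- msupp v) v@_m *: phi m.

Lemma mliftwE k v : (msize v <= k)%N ->
  mlift v = \sum_(m : 'X_{1..n < k}) v@_m *: phi m.
Proof.
move=> levk; rewrite /mlift (big_mksub 'X_{1..n < k}) ?msupp_uniq //=.
  by rewrite big_rmcond //= => m; move/memN_msupp_eq0 ->; rewrite scale0r.
by move=> m /msize_mdeg_lt /leq_trans; apply.
Qed.

Fact mlift_linear : linear mlift.
Proof.
move=> a v w; pose k := maxn (msize (a *: v + w)) (maxn (msize v) (msize w)).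
rewrite !(@mliftwE k) ?leq_max ?leqnn ?orbT // scaler_sumr -big_split.
by apply: eq_bigr => m _; rewrite mcoeffD mcoeffZ scalerDl scalerA.
Qed.
HB.instance Definition _ :=
  GRing.isLinear.Build R {mpoly R[n]} M _ mlift mlift_linear.

Lemma mliftX m : mlift 'X_[m] = phi m.
Proof. by rewrite /mlift msuppX big_seq1 mcoeffX eqxx scale1r. Qed.

End MonomialLift.

Section MapMpoly.
Variables (R S : nzRingType) (phi : {rmorphism R -> S}) (n : nat).
Local Notation map := (map_mpoly phi).
Implicit Type v : {mpoly R[n]}.

Lemma map_mpolyP a v w : map (a *: v + w) = phi a *: map v + map w.
Proof. by rewrite raddfD /= map_mpolyZ. Qed.

Lemma map_mpoly_mlift k (f : 'X_{1..n} -> {mpoly R[k]})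
    (g : 'X_{1..n} -> {mpoly S[k]}) v :
  (forall m, map_mpoly phi (f m) = g m) ->
  map_mpoly phi (mlift f v) = mlift g (map v).
Proof.
move=> fg; elim/mpoly_linear_ind: v => [a v w IHv IHw||m].
- rewrite linearP raddfD /= map_mpolyZ IHv IHw.
  by rewrite map_mpolyP linearP.
- by rewrite !(linear0, raddf0).
- by rewrite map_mpolyX !mliftX.
Qed.

Lemma map_mpoly_mderiv i v : map v^`M(i) = (map v)^`M(i).
Proof.
elim/mpoly_linear_ind: v => [a v w IHv IHw||m].
- by rewrite linearP !map_mpolyP linearP /= IHv IHw.
- by rewrite linear0 raddf0 linear0.
- by rewrite mderivX map_mpolyZ !map_mpolyX mderivX rmorph_nat.
Qed.

End MapMpoly.

Lemma sum_ord6 (M : nmodType) (F : 'I_6 -> M) :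
  \sum_i F i = F ih + F ie + F if_ + F ip + F iq + F iz.
Proof.
rewrite !big_ord_recl big_ord0 addr0 !addrA.
by do !congr (_ + _); congr (F _); apply: val_inj.
Qed.

(** * Modules over the infinitesimal Hecke algebra *)

Definition hweight (i : 'I_6) : int :=
  nth 0 [:: 0; 2%:Z; - 2%:Z; - 1%:Z; 1%:Z; 0] i.

(* [h^2 + 2 h + 4 f e] is the ordered form of the symmetrization of the Casimir
   element [h^2 + 4 e f]. *)
Definition casimir_op (R : nzRingType) (M : lmodType R)
    (op : 'I_6 -> {linear M -> M}) (x : M) : M :=
  op ih (op ih x) + op ih x *+ 2 + op if_ (op ie x) *+ 4.

Record hecke_module (R : nzRingType) (tau : R) (M : lmodType R)
    (op : 'I_6 -> {linear M -> M}) : Prop := HeckeModule {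
  op_z : forall i x, op iz (op i x) = op i (op iz x);
  op_h : forall i x, op ih (op i x) = op i (op ih x) + op i x *~ hweight i;
  op_f_p : forall x, op if_ (op ip x) = op ip (op if_ x);
  op_f_q : forall x, op if_ (op iq x) = op iq (op if_ x) + op ip x;
  op_e_p : forall x, op ie (op ip x) = op ip (op ie x) + op iq x;
  op_e_q : forall x, op ie (op iq x) = op iq (op ie x);
  op_e_f : forall x, op ie (op if_ x) = op if_ (op ie x) + op ih x;
  op_q_p : forall x, op iq (op ip x) =
    op ip (op iq x) + op iz x + tau *: casimir_op op x
}.

(** * The regular module *)

HB.lock Definition Hop (R : comNzRingType) (v : {mpoly R[6]}) : {mpoly R[6]} :=
  'X_ih * v + \sum_i ('X_i * v^`M(i)) *~ hweight i.

Section HOperator.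
Variable R : comNzRingType.
Implicit Types v : {mpoly R[6]}.

Fact Hop_linear : linear (@Hop R).
Proof.
move=> a v w; rewrite Hop.unlock mulrDr -scalerAr scalerDr addrACA.
congr (_ + _); rewrite scaler_sumr -big_split; apply: eq_bigr => i _ /=.
by rewrite linearP mulrDr -scalerAr mulrzDl scalerMzr.
Qed.
HB.instance Definition _ :=
  GRing.isLinear.Build R {mpoly R[6]} {mpoly R[6]} _ (@Hop R) Hop_linear.

Lemma Hop_mulX i v : Hop ('X_i * v) = 'X_i * Hop v + ('X_i * v) *~ hweight i.
Proof.
rewrite Hop.unlock !sum_ord6 !mderiv_mulX.
by elim/ord6P: i => /=; ring.
Qed.

Lemma Hop_mderiv i v :
  i != ih -> Hop v^`M(i) = (Hop v)^`M(i) - v^`M(i) *~ hweight i.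
Proof.
move=> ne_ih; rewrite Hop.unlock.
under eq_bigr do rewrite mderiv_comm.
have mderivMz u n : (u *~ n)^`M(i) = u^`M(i) *~ n by exact: raddfMz.
rewrite !sum_ord6 !(mderivD, mderivMz, mderiv_mulX) (negPf ne_ih).
by elim/ord6P: i ne_ih {mderivMz} => //= _; ring.
Qed.

Lemma Hop_mulE v :
  (Hop ('X_ip * v) = 'X_ip * Hop v - 'X_ip * v) *
  (Hop ('X_if_ * v) = 'X_if_ * Hop v - ('X_if_ * v) *+ 2) *
  (Hop ('X_iq * v) = 'X_iq * Hop v + 'X_iq * v) *
  (Hop ('X_ie * v) = 'X_ie * Hop v + ('X_ie * v) *+ 2) *
  (Hop ('X_iz * v) = 'X_iz * Hop v).
Proof. by do !split; rewrite Hop_mulX ?addr0. Qed.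

Lemma Hop_mderiv_f v : (Hop v)^`M(if_) = Hop v^`M(if_) - v^`M(if_) *+ 2.
Proof. by rewrite Hop_mderiv // -addrA addNr addr0. Qed.

Lemma mderiv_f_mulE v :
  (('X_if_ * v)^`M(if_) = v + 'X_if_ * v^`M(if_)) *
  (('X_ie * v)^`M(if_) = 'X_ie * v^`M(if_)) *
  (('X_iq * v)^`M(if_) = 'X_iq * v^`M(if_)) *
  (('X_ip * v)^`M(if_) = 'X_ip * v^`M(if_)) *
  (('X_iz * v)^`M(if_) = 'X_iz * v^`M(if_)).
Proof. by do !split; rewrite mderiv_mulX ?add0r. Qed.

Lemma Hop_mpolyX m :
  Hop 'X_[m] = 'X_[U_(ih) + m] + 'X_[m] *~ (\sum_i (m i)%:Z * hweight i)
  :> {mpoly R[6]}.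
Proof.
rewrite Hop.unlock mpolyXD; congr (_ + _); rewrite mulrz_sumr.
by apply: eq_bigr => i _; rewrite mulX_mderivX mulrzA.
Qed.

End HOperator.

Definition pdeg_le (R : comNzRingType) (n : nat) : {pred {mpoly R[6]}} :=
  fun v => all (fun m : 'X_{1..6} => m ip <= n)%N (msupp v).

Section DegreeFiltration.
Variable R : comNzRingType.
Local Notation V := {mpoly R[6]}.
Local Notation H := (@Hop R).
Implicit Types (v w : V) (m : 'X_{1..6}) (n : nat).

Fact pdeg_le_submod n : submod_closed (@pdeg_le R n).
Proof.
split=> [|a v w /allP dv /allP dw]; first by rewrite unfold_in msupp0.
apply/allP => m /msuppD_le; rewrite mem_cat => /orP[/msuppZ_le|].
  exact: dv.
exact: dw.
Qed.
HB.instance Definition _ n :=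
  GRing.isSubmodClosed.Build R V (@pdeg_le R n) (pdeg_le_submod n).

Lemma pdeg_leX n m : ('X_[m] \in @pdeg_le R n) = (m ip <= n)%N.
Proof. by rewrite unfold_in msuppX /= andbT. Qed.

Lemma pdeg_le_ind n (Pr : V -> Prop) :
  (forall a v w, Pr v -> Pr w -> Pr (a *: v + w)) -> Pr 0 ->
  (forall m, (m ip <= n)%N -> Pr 'X_[m]) -> {in pdeg_le n, forall v, Pr v}.
Proof.
move=> PD P0 PX v /allP dv; rewrite [v]mpolyE big_seq.
apply: (big_ind Pr) => [//|u w|m /dv/PX Xm]; last first.
  by rewrite -[_ *: _]addr0; apply: PD.
by rewrite -[u in u + w]scale1r; apply: PD.
Qed.

Lemma pdeg_leW n n' v : (n <= n')%N -> v \in pdeg_le n -> v \in pdeg_le n'.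
Proof. by move=> lenn' /allP dv; apply/allP => m /dv/leq_trans; apply. Qed.

Lemma pdeg_le_mulX n i v :
  v \in pdeg_le n -> 'X_i * v \in pdeg_le ((i == ip) + n).
Proof.
move: v; apply: pdeg_le_ind => [a v w dv dw||m dm].
- by rewrite mulrDr -scalerAr rpredD ?rpredZ.
- by rewrite mulr0 rpred0.
- by rewrite -mpolyXD pdeg_leX mnmDE mnm1E leq_add2l.
Qed.

Lemma pdeg_le_Hop n v : v \in pdeg_le n -> H v \in pdeg_le n.
Proof.
move: v; apply: pdeg_le_ind => [a v w dv dw||m dm].
- by rewrite linearP rpredD ?rpredZ.
- by rewrite linear0 rpred0.
- by rewrite Hop_mpolyX rpredD ?rpredMz // pdeg_leX // mnmDE mnm1E.
Qed.

Lemma pdeg_le_mderiv n i v : v \in pdeg_le n -> v^`M(i) \in pdeg_le n.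
Proof.
move: v; apply: pdeg_le_ind => [a v w dv dw||m dm].
- by rewrite linearP rpredD ?rpredZ.
- by rewrite linear0 rpred0.
- by rewrite mderivX rpredZ // pdeg_leX mnmBE (leq_trans (leq_subr _ _)).
Qed.
End DegreeFiltration.

(* The values of [e] and [q] on [p^i c], for [c] without [p], obtained by moving
   one factor [p] to the left with [e p = p e + q] and [q p = p q + z + tau C].
   For [i = 0], [e f^a = f^a e + a f^(a-1) h - a (a-1) f^(a-1)], and [Hop] also
   moves [h] across [f^(a-1)]. *)
Fixpoint lmul_e_q_pXM (R : comNzRingType) (tau : R) (i : nat)
    (c : {mpoly R[6]}) : {mpoly R[6]} * {mpoly R[6]} :=
  if i is j.+1 then
    let: (E, Q) := lmul_e_q_pXM tau j c in
    let w := 'X_ip ^+ j * c in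
    ('X_ip * E + Q,
     'X_ip * Q + 'X_iz * w
     + tau *: (Hop (Hop w) + Hop w *+ 2 + ('X_if_ * E) *+ 4))
  else ('X_ie * c + Hop c^`M(if_) + 'X_if_ * c^`M(if_)^`M(if_),
        'X_iq * c - 'X_ip * c^`M(if_)).

Definition lmul_e_q (R : comNzRingType) (tau : R) (m : 'X_{1..6}) :
    {mpoly R[6]} * {mpoly R[6]} := lmul_e_q_pXM tau (m ip) 'X_[mnm_del ip m].

HB.lock Definition Eop (R : comNzRingType) (tau : R) (v : {mpoly R[6]}) :
  {mpoly R[6]} := mlift (fun m => (lmul_e_q tau m).1) v.
HB.lock Definition Qop (R : comNzRingType) (tau : R) (v : {mpoly R[6]}) :
  {mpoly R[6]} := mlift (fun m => (lmul_e_q tau m).2) v.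

Section RegularModule.
Variables (R : comNzRingType) (tau : R).
Local Notation V := {mpoly R[6]}.
Local Notation H := (@Hop R).
Local Notation E := (Eop tau).
Local Notation Q := (Qop tau).
Local Notation "''p'" := ('X_ip : V).
Local Notation "''f'" := ('X_if_ : V).
Local Notation "''q'" := ('X_iq : V).
Local Notation "''e'" := ('X_ie : V).
Local Notation "''z'" := ('X_iz : V).
Implicit Types (v w c : V) (m : 'X_{1..6}).

Fact Eop_linear : linear E.
Proof. by move=> a v w; rewrite Eop.unlock linearP. Qed.
HB.instance Definition _ := GRing.isLinear.Build R V V _ E Eop_linear.
Fact Qop_linear : linear Q.
Proof. by move=> a v w; rewrite Qop.unlock linearP. Qed.
HB.instance Definition _ := GRing.isLinear.Build R V V _ Q Qop_linear.

Lemma Eop_mpolyX m : E 'X_[m] = (lmul_e_q tau m).1.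
Proof. by rewrite Eop.unlock mliftX. Qed.
Lemma Qop_mpolyX m : Q 'X_[m] = (lmul_e_q tau m).2.
Proof. by rewrite Qop.unlock mliftX. Qed.

Lemma lmul_e_q_mpolyX_p m (u := lmul_e_q tau m) :
  lmul_e_q tau (U_(ip) + m) =
    ('p * u.1 + u.2, 'p * u.2 + 'z * 'X_[m]
       + tau *: (H (H 'X_[m]) + H 'X_[m] *+ 2 + ('f * u.1) *+ 4)).
Proof.
rewrite /u /lmul_e_q mnmDE mnm1E mnm_del_addU /=.
by rewrite mpolyX_mnm_del; case: (lmul_e_q_pXM _ _ _).
Qed.

Lemma Eop_mulp v : E ('p * v) = 'p * E v + Q v.
Proof.
elim/mpoly_linear_ind: v => [a v w IHv IHw||m].
- rewrite mulrDr -scalerAr !linearP /= IHv IHw mulrDr -scalerAr.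
  by rewrite scalerDr addrACA.
- by rewrite mulr0 !linear0 mulr0 addr0.
- by rewrite -mpolyXD !Eop_mpolyX Qop_mpolyX lmul_e_q_mpolyX_p.
Qed.

Lemma Qop_mulp v : Q ('p * v) =
  'p * Q v + 'z * v + tau *: (H (H v) + H v *+ 2 + ('f * E v) *+ 4).
Proof.
elim/mpoly_linear_ind: v => [a v w IHv IHw||m].
- by rewrite mulrDr -scalerAr !linearP /= IHv IHw -!mul_mpolyC; ring.
- by rewrite !(mulr0, linear0, mul0rn, addr0).
- by rewrite -mpolyXD !Eop_mpolyX !Qop_mpolyX lmul_e_q_mpolyX_p.
Qed.

Lemma pdeg_le_lmul_e_q i c : c \in pdeg_le 0 ->
  (lmul_e_q_pXM tau i c).1 \in pdeg_le i /\
  (lmul_e_q_pXM tau i c).2 \in pdeg_le i.+1.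
Proof.
move=> dc.
have dfc : c^`M(if_) \in pdeg_le 0 by exact: pdeg_le_mderiv.
elim: i => [|i] /=.
  have df2c : c^`M(if_)^`M(if_) \in pdeg_le 0 by exact: pdeg_le_mderiv.
  split.
    by rewrite !rpredD ?(pdeg_le_mulX ie) ?(pdeg_le_mulX if_) ?pdeg_le_Hop.
  by rewrite rpredB ?(pdeg_le_mulX ip) // (pdeg_leW _ (pdeg_le_mulX iq dc)).
case: (lmul_e_q_pXM _ _ _) => Ew Qw /= [dE dQ].
have dw : 'p ^+ i * c \in pdeg_le i.
  elim: i {dE dQ} => [|i dw]; first by rewrite mul1r.
  by rewrite exprS -mulrA (pdeg_le_mulX ip).
split; first by rewrite rpredD ?(pdeg_le_mulX ip).
rewrite !rpredD ?(pdeg_le_mulX ip) //.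
  by apply: pdeg_leW (pdeg_le_mulX iz dw); apply: leq_trans (leqnSn _).
rewrite rpredZ // (@pdeg_leW _ i) ?leqW //.
by rewrite !rpredD ?rpredMn ?pdeg_le_Hop ?(pdeg_le_mulX if_).
Qed.

Lemma pdeg_le_Eop n v : v \in pdeg_le n -> E v \in pdeg_le n.
Proof.
move: v; apply: pdeg_le_ind => [a v w dv dw||m dm].
- by rewrite linearP rpredD ?rpredZ.
- by rewrite linear0 rpred0.
rewrite Eop_mpolyX; apply: pdeg_leW dm _.
have dX : 'X_[mnm_del ip m] \in @pdeg_le R 0 by rewrite pdeg_leX mnmE eqxx.
by have [] := pdeg_le_lmul_e_q (m ip) dX.
Qed.

Lemma Eop_pfree c : c \in pdeg_le 0 ->
  E c = 'e * c + H c^`M(if_) + 'f * c^`M(if_)^`M(if_).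
Proof.
move: c; apply: pdeg_le_ind => [a v w IHv IHw||m].
- by rewrite linearP /= IHv IHw !linearP /= -!mul_mpolyC; ring.
- by rewrite !(linear0, mulr0) !addr0.
rewrite leqn0 => /eqP mp0.
by rewrite Eop_mpolyX /lmul_e_q mp0 mnm_del_id.
Qed.

Lemma Qop_pfree c : c \in pdeg_le 0 -> Q c = 'q * c - 'p * c^`M(if_).
Proof.
move: c; apply: pdeg_le_ind => [a v w IHv IHw||m].
- by rewrite linearP /= IHv IHw !linearP /= -!mul_mpolyC; ring.
- by rewrite !(linear0, mulr0) addr0.
rewrite leqn0 => /eqP mp0.
by rewrite Qop_mpolyX /lmul_e_q mp0 mnm_del_id.
Qed.

Lemma lmul_e_q_mpolyX_z m (u := lmul_e_q tau m) :
  lmul_e_q tau (U_(iz) + m) = ('z * u.1, 'z * u.2).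
Proof.
rewrite /u /lmul_e_q mnmDE mnm1E add0n.
have -> : mnm_del ip (U_(iz) + m) = (U_(iz) + mnm_del ip m)%MM.
  by apply/mnmP => i; rewrite !mnmE; case: eqP => // ->.
rewrite mpolyXD; move: (m ip) 'X_[mnm_del ip m] => i c; elim: i => [|i IH] /=.
  by rewrite !mderiv_f_mulE Hop_mulE; congr (_, _); ring.
rewrite IH; case: (lmul_e_q_pXM tau i c) => Ec Qc /=.
by rewrite ['p ^+ i * _]mulrCA !Hop_mulE -!mul_mpolyC; congr (_, _); ring.
Qed.

Lemma Eop_mulz v : E ('z * v) = 'z * E v.
Proof.
elim/mpoly_linear_ind: v => [a v w IHv IHw||m].
- by rewrite mulrDr -scalerAr !linearP /= IHv IHw mulrDr -scalerAr.
- by rewrite mulr0 linear0 mulr0.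
- by rewrite -mpolyXD !Eop_mpolyX lmul_e_q_mpolyX_z.
Qed.

Lemma Qop_mulz v : Q ('z * v) = 'z * Q v.
Proof.
elim/mpoly_linear_ind: v => [a v w IHv IHw||m].
- by rewrite mulrDr -scalerAr !linearP /= IHv IHw mulrDr -scalerAr.
- by rewrite mulr0 linear0 mulr0.
- by rewrite -mpolyXD !Qop_mpolyX lmul_e_q_mpolyX_z.
Qed.

Definition sl2_rel v := E ('f * v) = 'f * E v + H v /\
                        H (E v) = E (H v) + E v *+ 2.
Definition doublet_rel v := [/\ H (Q v) = Q (H v) + Q v,
  E (Q v) = Q (E v) & 'f * Q v = Q ('f * v) + 'p * v].

Lemma sl2_rel_pfree c : c \in pdeg_le 0 -> sl2_rel c.
Proof.
move=> dc.
have dfc : 'f * c \in pdeg_le 0 by apply: (pdeg_le_mulX if_).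
rewrite /sl2_rel !Eop_pfree ?pdeg_le_Hop //.
have HD u w : H (u + w) = H u + H w by exact: raddfD.
have HB u w : H (u - w) = H u - H w by exact: raddfB.
have HMn u k : H (u *+ k) = H u *+ k by exact: raddfMn.
rewrite !(mderiv_f_mulE, mderivD, mderivB, mderivMn, Hop_mderiv_f).
by split;
  rewrite !(mderiv_f_mulE, mderivD, HD, HB, HMn, Hop_mderiv_f, Hop_mulE); ring.
Qed.

Lemma doublet_rel_pfree c : c \in pdeg_le 0 -> doublet_rel c.
Proof.
move=> dc.
have dX i v : i != ip -> v \in pdeg_le 0 -> 'X_i * v \in pdeg_le 0.
  by move=> /negPf ne_ip dv; have := pdeg_le_mulX i dv; rewrite ne_ip.
have dfc : c^`M(if_) \in pdeg_le 0 by apply: pdeg_le_mderiv.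
have dEc : E c \in pdeg_le 0 by apply: pdeg_le_Eop.
have Qfc := Qop_pfree (dX if_ c isT dc).
have Eqc := Eop_pfree (dX iq c isT dc).
have QHc := Qop_pfree (pdeg_le_Hop dc).
rewrite /doublet_rel Qfc QHc (Qop_pfree dEc) (Qop_pfree dc) !raddfB.
rewrite /= Eop_mulp Eqc (Eop_pfree dc) (Eop_pfree dfc).
rewrite (Qop_pfree dfc).
by split; rewrite !(mderiv_f_mulE, mderivD, Hop_mderiv_f, Hop_mulE); ring.
Qed.

Local Notation C v := (H (H v) + H v *+ 2 + ('f * E v) *+ 4).

Lemma Hop_casimir v : sl2_rel v -> H (C v) = C (H v).
Proof.
by case=> _ HEv; rewrite !(raddfD, raddfMn) /= Hop_mulE HEv; ring.
Qed.

Lemma casimir_mulf v : sl2_rel v -> C ('f * v) = 'f * C v.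
Proof.
by case=> Efv _; rewrite Efv !(Hop_mulE, raddfB, raddfMn) /= !Hop_mulE; ring.
Qed.

Lemma Eop_casimir v :
  sl2_rel v -> sl2_rel (E v) -> sl2_rel (H v) -> E (C v) = C (E v).
Proof.
case=> _ HEv [EfEv _] [_ HEHv].
have EHv : E (H v) = H (E v) - E v *+ 2 by rewrite HEv addrK.
have EHHv : E (H (H v)) = H (E (H v)) - E (H v) *+ 2 by rewrite HEHv addrK.
by rewrite !(raddfD, raddfMn) /= EfEv EHHv EHv !(raddfB, raddfMn) /=; ring.
Qed.

Lemma sl2_rel_p v : sl2_rel v -> doublet_rel v -> sl2_rel ('p * v).
Proof.
move=> [Efv HEv] [HQv EQv fQv]; split.
  have -> : 'f * ('p * v) = 'p * ('f * v) by ring.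
  by rewrite !Eop_mulp Hop_mulE Efv -[Q ('f * v)](addrK ('p * v)) -fQv; ring.
by rewrite Hop_mulE Eop_mulp raddfD raddfB /= Hop_mulE !Eop_mulp HEv HQv; ring.
Qed.

Lemma doublet_rel_p v :
  sl2_rel v -> sl2_rel (E v) -> sl2_rel (H v) -> doublet_rel v ->
  doublet_rel ('p * v).
Proof.
move=> rv rEv rHv [HQv EQv fQv]; split.
- rewrite Hop_mulE raddfB /= !Qop_mulp 2!raddfD /= linearZ /=.
  by rewrite (Hop_casimir rv) !Hop_mulE HQv -!mul_mpolyC; ring.
- rewrite Eop_mulp raddfD /= !Qop_mulp 2!raddfD /= linearZ /=.
  by rewrite (Eop_casimir rv rEv rHv) Eop_mulp Eop_mulz EQv -!mul_mpolyC; ring.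
have -> : 'f * ('p * v) = 'p * ('f * v) by ring.
rewrite !Qop_mulp (casimir_mulf rv) -[Q ('f * v)](addrK ('p * v)) -fQv.
by rewrite -!mul_mpolyC; ring.
Qed.

Lemma regular_rel v : sl2_rel v /\ doublet_rel v.
Proof.
have [n] : exists n, v \in pdeg_le n.
  exists (\max_(m <- msupp v) m ip)%N; apply/allP => m vm.
  exact: leq_bigmax_seq.
elim: n v => [|n IH] v dv.
  by split; [apply: sl2_rel_pfree | apply: doublet_rel_pfree].
move: v dv; apply: pdeg_le_ind => [a v w||m].
- case=> -[Efv HEv] [HQv EQv fQv] [[Efw HEw] [HQw EQw fQw]].
  rewrite /sl2_rel /doublet_rel !mulrDr -!scalerAr !linearP /=.
  rewrite !mulrDr -!scalerAr Efv HEv HQv EQv fQv Efw HEw HQw EQw fQw.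
  by rewrite -!mul_mpolyC; split; split; ring.
- by rewrite /sl2_rel /doublet_rel !(mulr0, linear0) !mul0rn !addr0.
rewrite leq_eqVlt => /orP[/eqP mp|mp]; last by apply: IH; rewrite pdeg_leX.
have [|m' mE] := @mnm_pos_split _ m ip; first by rewrite mp.
move: mp; rewrite mE mnmDE mnm1E eqxx => /eqP; rewrite eqSS => /eqP m'p.
have dm' : 'X_[m'] \in @pdeg_le R n by rewrite pdeg_leX -m'p.
have [sl2m' dbltm'] := IH _ dm'.
have [sl2Em' _] := IH _ (pdeg_le_Eop dm').
have [sl2Hm' _] := IH _ (pdeg_le_Hop dm').
by rewrite mpolyXD; split; [apply: sl2_rel_p | apply: doublet_rel_p].
Qed.

Local Notation endo := {linear V -> V}.

Definition regular_op (i : 'I_6) : endo :=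
  let mulX j : endo := 'X_j \*o idfun in
  nth (mulX iz) [:: H : endo; E : endo; mulX if_; mulX ip; Q : endo] i.

Lemma regular_module : hecke_module tau regular_op.
Proof.
split=> [i x|i x|x|x|x|x|x|x].
- by elim/ord6P: i; rewrite /= ?Hop_mulE ?Eop_mulz ?Qop_mulz //; apply: mulrCA.
- elim/ord6P: i; rewrite /= ?Hop_mulE ?addr0 //.
  + by have [[]] := regular_rel x.
  + by have [_ []] := regular_rel x.
- exact: mulrCA.
- by have [_ []] := regular_rel x.
- exact: Eop_mulp.
- by have [_ []] := regular_rel x.
- by have [[]] := regular_rel x.
- exact: Qop_mulp.
Qed.

Lemma regular_op_1 i : regular_op i 1 = 'X_i.
Proof.
have d1 : (1 : V) \in pdeg_le 0 by rewrite -mpolyX0 pdeg_leX mnm0E.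
have Hop1 : H 1 = 'X_ih.
  rewrite Hop.unlock mulr1 big1 ?addr0 // => j _.
  by rewrite mderiv1 mulr0 mul0rz.
elim/ord6P: i; rewrite /= ?mulr1 //.
  by rewrite Eop_pfree // !(mderiv1, linear0) mulr1 !mulr0 !addr0.
by rewrite Qop_pfree // mderiv1 mulr1 mulr0 subr0.
Qed.

Lemma mpolyX_regular_op m : m != 0%MM -> exists i m' a,
  m = (U_(i) + m')%MM /\ 'X_[m] = a *: 'X_[m'] + regular_op i 'X_[m'].
Proof.
have lmulX i m' : m = (U_(i) + m')%MM ->
    regular_op i 'X_[m'] = 'X_i * 'X_[m'] -> exists i m' a,
      m = (U_(i) + m')%MM /\ 'X_[m] = a *: 'X_[m'] + regular_op i 'X_[m'].
  by move=> mE regE; exists i, m', 0; rewrite scale0r add0r regE -mpolyXD -mE.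
move=> m_neq0.
have [mz|/mnm_pos_split[m' mE]] := posnP (m iz); last exact: lmulX mE _.
have [mp|/mnm_pos_split[m' mE]] := posnP (m ip); last exact: lmulX mE _.
have [mf|/mnm_pos_split[m' mE]] := posnP (m if_); last exact: lmulX mE _.
have m'pf i m' : m = (U_(i) + m')%MM -> m' ip = 0%N /\ m' if_ = 0%N.
  move=> mE; move: mp mf; rewrite mE !mnmDE => /eqP + /eqP.
  by rewrite !addn_eq0 => /andP[_ /eqP ->] /andP[_ /eqP ->].
have [mq|/mnm_pos_split[m' mE]] := posnP (m iq); last first.
  have [m'p m'f] := m'pf _ _ mE; apply: lmulX mE _.
  by rewrite /= Qop_pfree ?pdeg_leX ?m'p // mderivX_eq0 // mulr0 subr0.
have [me|/mnm_pos_split[m' mE]] := posnP (m ie); last first.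
  have [m'p m'f] := m'pf _ _ mE; apply: lmulX mE _.
  rewrite /= Eop_pfree ?pdeg_leX ?m'p // mderivX_eq0 //.
  by rewrite !linear0 mulr0 !addr0.
have [mh|/mnm_pos_split[m' mE]] := posnP (m ih); last first.
  exists ih, m', (- (\sum_i (m' i)%:Z * hweight i)%:~R).
  by rewrite {2}mE /= Hop_mpolyX scaleNr scaler_int addrCA addNr addr0.
by case/eqP: m_neq0; apply/mnmP; elim/ord6P; rewrite mnm0E.
Qed.

Lemma regular_ind (Pr : V -> Prop) :
  (forall a v w, Pr v -> Pr w -> Pr (a *: v + w)) -> Pr 1 ->
  (forall i v, Pr v -> Pr (regular_op i v)) -> forall v, Pr v.
Proof.
move=> PD P1 Pop.
have P0 : Pr 0 by rewrite -(addNr 1) -scaleN1r; apply: PD.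
apply: mpoly_linear_ind => // m.
have [n] := ubnP (mdeg m); elim: n m => // n IH m; rewrite ltnS => lemn.
have [->|/mpolyX_regular_op[i [m' [a [mE ->]]]]] := eqVneq m 0%MM.
  by rewrite mpolyX0.
have Pm' : Pr 'X_[m'] by apply: IH; rewrite mE mdegD mdeg1 in lemn.
by apply: PD => //; apply: Pop.
Qed.

End RegularModule.

(** * The action of ordered monomials on a module *)

Section IterLinear.
Variables (R : nzRingType) (M : lmodType R).

Fact iter_linear (f : {linear M -> M}) n : linear (iter n f).
Proof. by move=> a x y; elim: n => //= n ->; rewrite linearP. Qed.
HB.instance Definition _ (f : {linear M -> M}) n :=
  GRing.isLinear.Build R M M _ (iter n f) (iter_linear f n).

Lemma iter_comm (f g : M -> M) n x :
  (forall y, f (g y) = g (f y)) -> f (iter n g x) = iter n g (f x).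
Proof. by move=> fg; elim: n => //= n IH; rewrite fg IH. Qed.

End IterLinear.

Definition monomial_op (R : nzRingType) (M : lmodType R)
    (op : 'I_6 -> {linear M -> M}) (m : 'X_{1..6}) (x : M) : M :=
  let pow i := iter (m i) (op i) in
  pow ip (pow if_ (pow iq (pow ie (pow ih (pow iz x))))).

HB.lock Definition act (R : nzRingType) (M : lmodType R)
    (op : 'I_6 -> {linear M -> M}) (x : M) (v : {mpoly R[6]}) : M :=
  mlift (fun m => monomial_op op m x) v.

Section Action.
Variables (R : comNzRingType) (tau : R) (M : lmodType R).
Variable op : 'I_6 -> {linear M -> M}.
Hypothesis opM : hecke_module tau op.
Local Notation V := {mpoly R[6]}.
Implicit Types (x y : M) (v w : V) (m : 'X_{1..6}).

Fact act_linear x : linear (act op x).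
Proof. by move=> a v w; rewrite act.unlock linearP. Qed.
HB.instance Definition _ x :=
  GRing.isLinear.Build R V M _ (act op x) (act_linear x).

Lemma act_mpolyX x m : act op x 'X_[m] = monomial_op op m x.
Proof. by rewrite act.unlock mliftX. Qed.

Lemma act_1 x : act op x 1 = x.
Proof. by rewrite -mpolyX0 act_mpolyX /monomial_op !mnm0E. Qed.

Lemma act_intertwine (f : {linear V -> V}) (g : {linear M -> M}) x :
  (forall m, act op x (f 'X_[m]) = g (monomial_op op m x)) ->
  forall v, act op x (f v) = g (act op x v).
Proof.
move=> fg; elim/mpoly_linear_ind => [a v w IHv IHw||m].
- by rewrite !linearP /= IHv IHw.
- by rewrite !linear0.
- by rewrite act_mpolyX.
Qed.

Lemma act_p x v : act op x ('X_ip * v) = op ip (act op x v).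
Proof.
apply: (@act_intertwine ('X_ip \*o idfun) (op ip)) => m /=.
by rewrite -mpolyXD act_mpolyX /monomial_op !mnmDE !mnm1E.
Qed.

Lemma act_f x v : act op x ('X_if_ * v) = op if_ (act op x v).
Proof.
apply: (@act_intertwine ('X_if_ \*o idfun) (op if_)) => m /=.
rewrite -mpolyXD act_mpolyX /monomial_op !mnmDE !mnm1E /=.
by rewrite [RHS]iter_comm //; apply: op_f_p opM.
Qed.

Lemma act_z x v : act op x ('X_iz * v) = op iz (act op x v).
Proof.
apply: (@act_intertwine ('X_iz \*o idfun) (op iz)) => m /=.
rewrite -mpolyXD act_mpolyX /monomial_op !mnmDE !mnm1E /=.
by rewrite !(iter_comm _ _ (op_z opM _)).
Qed.

Lemma iter_op_h i n y : op ih (iter n (op i) y) =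
  iter n (op i) (op ih y) + iter n (op i) y *~ (n%:Z * hweight i).
Proof.
elim: n => [|n IH] /=; first by rewrite mul0r mulr0z addr0.
rewrite (op_h opM) IH linearD raddfMz /= -addrA -mulrzDr.
by rewrite intS mulrDl mul1r [hweight i + _]addrC.
Qed.

Lemma act_h x v : act op x (Hop v) = op ih (act op x v).
Proof.
apply: (@act_intertwine (@Hop R) (op ih)) => m /=.
rewrite Hop_mpolyX linearD raddfMz /= !act_mpolyX.
rewrite /monomial_op !mnmDE !mnm1E !add0n /=.
rewrite (iter_op_h ip) (iter_op_h if_) (iter_op_h iq) (iter_op_h ie).
rewrite !(linearD, raddfMz) /= -!addrA -!mulrzDr; congr (_ + _ *~ _).
by rewrite sum_ord6 /hweight /=; ring.
Qed.

Lemma iter_op_e_f n y : op ie (iter n.+1 (op if_) y) =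
  iter n.+1 (op if_) (op ie y)
  + (op ih (iter n (op if_) y) + iter n (op if_) y *+ n) *+ n.+1.
Proof.
have op_f_h z : op if_ (op ih z) = op ih (op if_ z) + op if_ z *+ 2.
  by rewrite (op_h opM) -addrA addNr addr0.
elim: n => [|n IH]; first by rewrite /= (op_e_f opM) addr0.
rewrite [iter n.+2 _ y]/= (op_e_f opM) -[op if_ (iter n _ y)]/(iter n.+1 _ y).
rewrite IH linearD raddfMn /= linearD raddfMn /= op_f_h.
rewrite -addrA; congr (_ + _); rewrite -[_ + _ + _ *+ n]addrA -mulrnDr add2n.
by rewrite mulrnDl [in RHS]mulrnDl addrAC -mulrSr -!mulrnA mulnC.
Qed.

Lemma iter_op_q_f n y : op iq (iter n.+1 (op if_) y) =
  iter n.+1 (op if_) (op iq y) - op ip (iter n (op if_) y) *+ n.+1.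
Proof.
have op_q_f z : op iq (op if_ z) = op if_ (op iq z) - op ip z.
  by rewrite (op_f_q opM) addrK.
elim: n => [|n IH]; first exact: op_q_f.
rewrite [iter n.+2 _ y]/= op_q_f -[op if_ (iter n _ y)]/(iter n.+1 _ y) IH.
by rewrite linearB raddfMn /= (op_f_p opM) -addrA -opprD -mulrSr.
Qed.

Lemma act_lmul_e_q_pfree x m : m ip = 0%N ->
  act op x (lmul_e_q tau m).1 = op ie (monomial_op op m x) /\
  act op x (lmul_e_q tau m).2 = op iq (monomial_op op m x).
Proof.
move=> mp; rewrite -Eop_mpolyX -Qop_mpolyX.
rewrite Eop_pfree ?Qop_pfree ?pdeg_leX ?mp //.
pose y := iter (m iq) (op iq) (iter (m ie) (op ie) (iter (m ih) (op ih)
  (iter (m iz) (op iz) x))).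
have mE : monomial_op op m x = iter (m if_) (op if_) y.
  by rewrite /monomial_op mp.
have eE : act op x ('X_ie * 'X_[m]) = iter (m if_) (op if_) (op ie y).
  rewrite -mpolyXD act_mpolyX /monomial_op !mnmDE !mnm1E mp !add0n /=.
  by rewrite /y [in RHS]iter_comm //; apply: op_e_q opM.
have qE : act op x ('X_iq * 'X_[m]) = iter (m if_) (op if_) (op iq y).
  by rewrite -mpolyXD act_mpolyX /monomial_op !mnmDE !mnm1E mp !add0n.
rewrite !linearD linearN /= eE qE act_p act_h act_f mE.
have [mf|/mnm_pos_split[m' m'E]] := posnP (m if_).
  by rewrite mderivX_eq0 // !linear0 mf !addr0.
have [m'p m'f] : m' ip = 0%N /\ m if_ = (m' if_).+1.
  by move: mp; rewrite m'E !mnmDE !mnm1E.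
have m'E' : monomial_op op m' x = iter (m' if_) (op if_) y.
  by rewrite /monomial_op m'p /y m'E !mnmDE !mnm1E !add0n.
have fdf : op if_ (act op x ('X_[m'])^`M(if_)) = monomial_op op m' x *+ m' if_.
  by rewrite -act_f mulX_mderivX raddfMn /= act_mpolyX.
have dfE : 'X_[m]^`M(if_) = 'X_[m'] *+ (m' if_).+1 :> V.
  by rewrite m'E mderivXD1.
rewrite dfE mderivMn !raddfMn /= fdf act_mpolyX m'E' m'f.
by rewrite iter_op_e_f iter_op_q_f mulNrn -addrA -mulrnDl.
Qed.

Lemma act_lmul_e_q x m :
  act op x (lmul_e_q tau m).1 = op ie (monomial_op op m x) /\
  act op x (lmul_e_q tau m).2 = op iq (monomial_op op m x).
Proof.
elim: {m}(m ip) {-2}m (erefl (m ip)) => [|i IH] m mp.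
  exact: act_lmul_e_q_pfree.
have [|m' mE] := @mnm_pos_split _ m ip; first by rewrite mp.
move: mp; rewrite mE mnmDE mnm1E eqxx => /eqP.
rewrite eqSS => /eqP/IH[IHe IHq].
have -> : monomial_op op (U_(ip) + m') x = op ip (monomial_op op m' x).
  by rewrite -!act_mpolyX mpolyXD act_p.
rewrite (op_e_p opM) (op_q_p opM) lmul_e_q_mpolyX_p; split.
  by rewrite linearD /= act_p IHe IHq.
rewrite 2!linearD /= linearZ /= act_p IHq act_z act_mpolyX.
by rewrite !(linearD, raddfMn) /= act_f IHe !act_h act_mpolyX.
Qed.

Lemma act_regular_op i x v : act op x (regular_op tau i v) = op i (act op x v).
Proof.
elim/ord6P: i.
- exact: act_h.
- apply: (@act_intertwine (Eop tau) (op ie)) => m /=; rewrite Eop_mpolyX.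
  by have [] := act_lmul_e_q x m.
- exact: act_f.
- exact: act_p.
- apply: (@act_intertwine (Qop tau) (op iq)) => m /=; rewrite Qop_mpolyX.
  by have [] := act_lmul_e_q x m.
- exact: act_z.
Qed.

End Action.

(** * The product *)

Definition hecke_mul (R : comNzRingType) (tau : R) (v w : {mpoly R[6]}) :
  {mpoly R[6]} := act (regular_op tau) w v.

Section HeckeProduct.
Variables (R : comNzRingType) (tau : R).
Local Notation V := {mpoly R[6]}.
Local Notation reg := (regular_op tau).
Local Notation mul := (hecke_mul tau).
Implicit Types u v w : V.

Lemma hecke_mul_linearl w : linear (mul^~ w).
Proof. exact: act_linear. Qed.

Lemma hecke_mulDl u v w : mul (u + v) w = mul u w + mul v w.
Proof. exact: linearD. Qed.

Lemma hecke_mulZl a v w : mul (a *: v) w = a *: mul v w.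
Proof. exact: linearZ. Qed.

Lemma hecke_mul_op i v w : mul (reg i v) w = reg i (mul v w).
Proof. exact: act_regular_op (regular_module tau) _ _ _. Qed.

Lemma hecke_mul1l v : mul 1 v = v.
Proof. exact: act_1. Qed.

Lemma act_linear_pt (M : lmodType R) (op : 'I_6 -> {linear M -> M}) v :
  hecke_module tau op -> linear (fun x => act op x v).
Proof.
move=> opM a x y.
elim/(regular_ind (tau := tau)): v => [b v w IHv IHw||i v IHv].
- by rewrite !linearP /= IHv IHw !scalerDr !scalerA mulrC addrACA.
- by rewrite !act_1.
- by rewrite !(act_regular_op opM) IHv linearP.
Qed.

Lemma hecke_mul_linearr v : linear (mul v).
Proof. exact: act_linear_pt (regular_module tau). Qed.
HB.instance Definition _ v :=
  GRing.isLinear.Build R V V _ (mul v) (hecke_mul_linearr v).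

Lemma hecke_mulDr u v w : mul u (v + w) = mul u v + mul u w.
Proof. exact: linearD. Qed.

Lemma hecke_mulZr a v w : mul v (a *: w) = a *: mul v w.
Proof. exact: linearZ. Qed.

Lemma act_hecke_mul (M : lmodType R) (op : 'I_6 -> {linear M -> M}) x v w :
  hecke_module tau op -> act op x (mul v w) = act op (act op x w) v.
Proof.
move=> opM; elim/(regular_ind (tau := tau)): v => [b u v IHu IHv||i v IHv].
- by rewrite hecke_mul_linearl !linearP /= IHu IHv.
- by rewrite hecke_mul1l act_1.
- by rewrite hecke_mul_op !(act_regular_op opM) IHv.
Qed.

Lemma hecke_mulA u v w : mul u (mul v w) = mul (mul u v) w.
Proof. by rewrite [RHS](act_hecke_mul _ _ _ (regular_module tau)). Qed.

Lemma hecke_mul1r v : mul v 1 = v.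
Proof.
elim/(regular_ind (tau := tau)): v => [b u v IHu IHv||i v IHv].
- by rewrite hecke_mul_linearl IHu IHv.
- exact: hecke_mul1l.
- by rewrite hecke_mul_op IHv.
Qed.

Lemma hecke_mulX i v : mul 'X_i v = reg i v.
Proof. by rewrite -(regular_op_1 tau) hecke_mul_op hecke_mul1l. Qed.

End HeckeProduct.

Section BaseChange.
Variables (R S : comNzRingType) (phi : {rmorphism R -> S}) (tau : R).
Local Notation map := (map_mpoly phi).
Implicit Types (v w : {mpoly R[6]}).

Let mapD v w : map (v + w) = map v + map w := rmorphD map v w.
Let mapN v : map (- v) = - map v := rmorphN map v.
Let mapM v w : map (v * w) = map v * map w := rmorphM map v w.
Let mapMn v n : map (v *+ n) = map v *+ n := rmorphMn map n v.
Let mapZ a v : map (a *: v) = phi a *: map v := map_mpolyZ phi a v.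
Let mapE := (mapD, mapN, mapM, mapMn, mapZ).

Lemma map_mpoly_Hop v : map (Hop v) = Hop (map v).
Proof.
rewrite Hop.unlock !mapE map_mpolyX rmorph_sum; congr (_ + _).
apply: eq_bigr => i _.
by rewrite raddfMz /= mapM map_mpolyX map_mpoly_mderiv.
Qed.

Lemma map_mpoly_lmul_e_q_pXM i c :
  lmul_e_q_pXM (phi tau) i (map c) =
  (map (lmul_e_q_pXM tau i c).1, map (lmul_e_q_pXM tau i c).2).
Proof.
elim: i => [|i IH] /=.
  by rewrite !mapE map_mpoly_Hop !map_mpoly_mderiv !map_mpolyX.
rewrite IH; case: (lmul_e_q_pXM tau i c) => Ec Qc /=.
by rewrite !mapE !map_mpoly_Hop !mapE rmorphXn /= !map_mpolyX.
Qed.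

Lemma map_mpoly_lmul_e_q m :
  lmul_e_q (phi tau) m = (map (lmul_e_q tau m).1, map (lmul_e_q tau m).2).
Proof. by rewrite /lmul_e_q -(map_mpolyX phi) map_mpoly_lmul_e_q_pXM. Qed.

Lemma map_mpoly_regular_op i v :
  map (regular_op tau i v) = regular_op (phi tau) i (map v).
Proof.
elim/ord6P: i => /=; rewrite ?mapE ?map_mpolyX ?map_mpoly_Hop //.
- rewrite Eop.unlock; apply: map_mpoly_mlift => m.
  by rewrite map_mpoly_lmul_e_q.
- rewrite Qop.unlock; apply: map_mpoly_mlift => m.
  by rewrite map_mpoly_lmul_e_q.
Qed.

Lemma map_mpoly_hecke_mul v w :
  map (hecke_mul tau v w) = hecke_mul (phi tau) (map v) (map w).
Proof.
elim/(regular_ind (tau := tau)): v => [a u v IHu IHv||i v IHv].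
- by rewrite hecke_mul_linearl !mapE hecke_mul_linearl IHu IHv.
- by rewrite rmorph1 !hecke_mul1l.
- by rewrite hecke_mul_op !map_mpoly_regular_op hecke_mul_op IHv.
Qed.

End BaseChange.

(** * The enveloping algebra *)

Section LieAlgebra.
Variable K : fieldType.
Local Notation g := (sl2n3 K).
Local Notation b := (basisg K).

Lemma lie_h_basis i : lie (b ih) (b i) = b i *~ hweight i.
Proof.
by elim/ord6P: i; apply: coordgP; elim/ord6P;
  rewrite /lie /= !coordgE raddfMz /= !coordg_basis /hweight /=; ring.
Qed.

Lemma lie_z (x : g) : lie (b iz) x = 0.
Proof.
by apply: coordgP; elim/ord6P;
  rewrite /lie /= !coordgE raddf0 !coordg_basis /=; ring.
Qed.

Lemma lie_basis :
  (lie (b ie) (b if_) = b ih) * (lie (b ie) (b ip) = b iq) *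
  (lie (b ie) (b iq) = 0) * (lie (b if_) (b ip) = 0) *
  (lie (b if_) (b iq) = b ip) * (lie (b iq) (b ip) = b iz).
Proof.
by do !split; apply: coordgP; elim/ord6P;
  rewrite /lie /= !coordgE ?raddf0 !coordg_basis /=; ring.
Qed.

Lemma linear_coordgE (M : lmodType K) (f : g -> M) x :
  linear f -> f x = \sum_i coordg i x *: f (b i).
Proof.
move=> fL.
pose f' := HB.pack_for {linear g -> M} f (GRing.isLinear.Build K g M *:%R f fL).
rewrite {1}[x]sum_coordg -[f]/(f' : g -> M) linear_sum.
by apply: eq_bigr => i _; rewrite linearZ.
Qed.

Lemma ce_cochain2N (L : lieAlgType K) (M : lmodType K) (c : L -> L -> M) x y :
  ce_cochain2 c -> c y x = - c x y.
Proof.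
move=> [cl cr cxx]; apply/eqP; rewrite -addr_eq0 addrC -(cxx (x + y)).
have cDl u v w : c (u + v) w = c u w + c v w.
  by have := cl w 1 u v; rewrite !scale1r.
have cDr u v w : c u (v + w) = c u v + c u w.
  by have := cr u 1 v w; rewrite !scale1r.
by rewrite cDl !cDr !cxx add0r addr0.
Qed.

Lemma eq_ce_cochain2 (M : lmodType K) (c c' : g -> g -> M) :
  ce_cochain2 c -> ce_cochain2 c' ->
  (forall i j : 'I_6, (i < j)%N -> c (b i) (b j) = c' (b i) (b j)) ->
  forall x y, c x y = c' x y.
Proof.
move=> cP c'P cc' x y; have [cl cr cxx] := cP; have [c'l c'r c'xx] := c'P.
rewrite (linear_coordgE x (cl y)) (linear_coordgE x (c'l y)).
apply: eq_bigr => i _; congr (_ *: _).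
rewrite (linear_coordgE y (cr _)) (linear_coordgE y (c'r _)).
apply: eq_bigr => j _; congr (_ *: _).
have [/cc' //|/cc' cji|/val_inj ->] := ltngtP i j; last by rewrite cxx c'xx.
by rewrite (ce_cochain2N _ _ cP) (ce_cochain2N _ _ c'P) cji.
Qed.

End LieAlgebra.

(* The basis of ordered monomials identifies the enveloping algebra with the
   symmetric algebra as a vector space. *)
Definition uea (K : fieldType) : Type := {mpoly K[6]}.
HB.instance Definition _ (K : fieldType) := GRing.Lmodule.on (uea K).

Section EnvelopingAlgebra.
Variable K : fieldType.
Local Notation U := (uea K).
Local Notation reg := (regular_op (0 : K)).

Definition uea_mul (u v : U) : U := hecke_mul 0 u v.
Definition uea_one : U := (1 : {mpoly K[6]}).

Fact uea_mulA : associative uea_mul.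
Proof. exact: hecke_mulA. Qed.
Fact uea_mul1l : left_id uea_one uea_mul.
Proof. exact: hecke_mul1l. Qed.
Fact uea_mul1r : right_id uea_one uea_mul.
Proof. exact: hecke_mul1r. Qed.
Fact uea_mulDl : left_distributive uea_mul +%R.
Proof. exact: hecke_mulDl. Qed.
Fact uea_mulDr : right_distributive uea_mul +%R.
Proof. exact: hecke_mulDr. Qed.
Fact uea_one_neq0 : uea_one != 0.
Proof. exact: oner_neq0. Qed.
HB.instance Definition _ := GRing.Zmodule_isNzRing.Build U
  uea_mulA uea_mul1l uea_mul1r uea_mulDl uea_mulDr uea_one_neq0.

Fact uea_scaleAl (a : K) (u v : U) : a *: uea_mul u v = uea_mul (a *: u) v.
Proof. exact: esym (hecke_mulZl 0 a u v). Qed.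
HB.instance Definition _ := GRing.Lmodule_isLalgebra.Build K U uea_scaleAl.
Fact uea_scaleAr (a : K) (u v : U) : a *: uea_mul u v = uea_mul u (a *: v).
Proof. exact: esym (hecke_mulZr 0 a u v). Qed.
HB.instance Definition _ := GRing.Lalgebra_isAlgebra.Build K U uea_scaleAr.

Local Notation g := (sl2n3 K).
Local Notation b := (basisg K).

Definition uea_incl (x : g) : U := sym_incl x.

Fact uea_incl_linear : linear uea_incl.
Proof. exact: sym_incl_linear. Qed.
HB.instance Definition _ :=
  GRing.isLinear.Build K g U _ uea_incl uea_incl_linear.

Lemma uea_incl_basis i : uea_incl (b i) = 'X_i :> {mpoly K[6]}.
Proof.
rewrite /uea_incl /sym_incl (bigD1 i) //= coordg_basis eqxx scale1r.
rewrite big1 ?addr0 // => j ne_ji.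
by rewrite coordg_basis (negPf ne_ji) scale0r.
Qed.

Lemma uea_gen_mul i (u : U) : uea_incl (b i) * u = reg i u.
Proof. by rewrite uea_incl_basis; apply: hecke_mulX. Qed.

Lemma uea_ind (Pr : U -> Prop) :
  (forall a u v, Pr u -> Pr v -> Pr (a *: u + v)) -> Pr 1 ->
  (forall i u, Pr u -> Pr (uea_incl (b i) * u)) -> forall u, Pr u.
Proof.
move=> PD P1 Pgen; apply: (regular_ind (tau := 0)) => // i u Pu.
by rewrite -uea_gen_mul; apply: Pgen.
Qed.

Lemma uea_incl_lie : lie_to_assoc uea_incl.
Proof.
move=> x y.
apply: (@eq_ce_cochain2 K U (fun x y => uea_incl (lie x y))
  (fun x y => uea_incl x * uea_incl y - uea_incl y * uea_incl x)).
- split=> [w a u v|w a u v|u]; last by rewrite liexx linear0.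
    by rewrite lie_linearl linearP.
  by rewrite lie_linearr linearP.
- split=> [w a u v|w a u v|u]; last by rewrite subrr.
    by rewrite linearP mulrDl mulrDr opprD addrACA scalerBr -scalerAl -scalerAr.
  by rewrite linearP mulrDl mulrDr opprD addrACA scalerBr -scalerAl -scalerAr.
move=> {x y} i j.
have reg1 k : uea_incl (b k) = reg k 1 :> U by rewrite -uea_gen_mul mulr1.
have regM := regular_module (0 : K).
rewrite !uea_gen_mul !reg1; have [->|ne_ih] := eqVneq i ih.
  by rewrite lie_h_basis raddfMz /= reg1 (op_h regM) addrC addKr.
have [->|ne_jz] := eqVneq j iz.
  by rewrite lieN lie_z oppr0 linear0 (op_z regM) subrr.
elim/ord6P: i ne_ih; elim/ord6P: j ne_jz => // _ _ _.
- by rewrite lie_basis reg1 (op_e_f regM) addrC addKr.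
- by rewrite lie_basis reg1 (op_e_p regM) addrC addKr.
- by rewrite lie_basis (op_e_q regM) subrr linear0.
- by rewrite lie_basis (op_f_p regM) subrr linear0.
- by rewrite lie_basis reg1 (op_f_q regM) addrC addKr.
rewrite lieN lie_basis linearN /= reg1 -[RHS]opprB (op_q_p regM) scale0r addr0.
by rewrite addrC addKr.
Qed.

Section Lift.
Variables (A : algType K) (f : {linear g -> A}).
Hypothesis fP : lie_to_assoc f.

Definition lift_op (i : 'I_6) : {linear A -> A} := f (b i) \*o idfun.

Lemma lift_op_lie i j x : lift_op i (lift_op j x) =
  lift_op j (lift_op i x) + f (lie (b i) (b j)) * x.
Proof. by rewrite /= fP mulrBl !mulrA addrC subrK. Qed.

Lemma lift_module : hecke_module 0 lift_op.
Proof.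
split=> [i x|i x|x|x|x|x|x|x]; rewrite lift_op_lie.
- by rewrite lie_z linear0 mul0r addr0.
- by rewrite lie_h_basis raddfMz /= mulrzAl.
- by rewrite lie_basis linear0 mul0r addr0.
- by rewrite lie_basis.
- by rewrite lie_basis.
- by rewrite lie_basis linear0 mul0r addr0.
- by rewrite lie_basis.
- by rewrite lie_basis scale0r addr0.
Qed.

Lemma act_lift_gen_mul i (u : U) :
  act lift_op 1 (uea_incl (b i) * u : U) = f (b i) * act lift_op 1 u.
Proof. by rewrite uea_gen_mul (act_regular_op lift_module). Qed.

Fact act_lift_monoid : monoid_morphism (act lift_op 1 : U -> A).
Proof.
have act1 : act lift_op 1 (1 : U) = 1 by apply: act_1.
split=> // u v; elim/uea_ind: u => [a u w IHu IHw||i u IHu].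
- rewrite mulrDl -scalerAl.
  by rewrite !(act_linear lift_op 1) /= IHu IHw mulrDl -scalerAl.
- by rewrite act1 !mul1r.
- by rewrite -mulrA !act_lift_gen_mul IHu mulrA.
Qed.

Definition uea_lift : {lrmorphism U -> A} :=
  HB.pack_for {lrmorphism U -> A} (act lift_op 1 : U -> A)
    (GRing.isLinear.Build K U A _ (act lift_op 1 : U -> A)
       (act_linear lift_op 1))
    (GRing.isMonoidMorphism.Build U A (act lift_op 1 : U -> A)
       act_lift_monoid).

Lemma uea_lift_incl x : uea_lift (uea_incl x) = f x.
Proof.
have liftP : linear (uea_lift \o uea_incl) by exact: linearP.
rewrite -[LHS]/((uea_lift \o uea_incl) x) (linear_coordgE _ liftP).
rewrite [RHS](linear_coordgE _ (linearP f)); apply: eq_bigr => i _.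
by congr (_ *: _); rewrite /= -[uea_incl _]mulr1 act_lift_gen_mul act_1 mulr1.
Qed.

Lemma uea_lift_unique (G : {lrmorphism U -> A}) :
  (forall x, G (uea_incl x) = f x) -> G =1 uea_lift.
Proof.
move=> Gincl; elim/uea_ind => [a u v IHu IHv||i u IHu].
- by rewrite !linearP /= IHu IHv.
- by rewrite !rmorph1.
- by rewrite rmorphM /= Gincl IHu /= act_lift_gen_mul.
Qed.

End Lift.

Lemma universal_enveloping_uea : universal_enveloping uea_incl.
Proof.
split=> [|A f fP]; first exact: uea_incl_lie.
exists (uea_lift fP); split; first exact: uea_lift_incl.
exact: uea_lift_unique.
Qed.

End EnvelopingAlgebra.

Arguments uea_lift : simpl never.

(** * The deformation *)

(* A polynomial in [t] stands for a truncated power series. *)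
Definition series_const (K : fieldType) (u : uea K) : {mpoly {poly K}[6]} :=
  map_mpoly (@polyC K) u.

Definition series_coef (K : fieldType) (n : nat) (v : {mpoly {poly K}[6]}) :
  uea K := map_mpoly (coefp n) v.

Definition uea_deformation (K : fieldType) (n : nat) (u v : uea K) : uea K :=
  series_coef n (hecke_mul 'X (series_const u) (series_const v)).

Lemma sum_ord_delta (M : nmodType) n r (F : nat -> M) :
  (forall i, i != r -> F i = 0) ->
  \sum_(i < n) F i = if (r < n)%N then F r else 0.
Proof.
move=> F0; rewrite (bigID (fun i : 'I_n => i == r :> nat)) /= big_ord1_eq.
by rewrite [X in _ + X]big1 ?addr0 // => i; apply: F0.
Qed.

(* Only the first [n + 1] coefficients enter the [n]-th coefficient of a
   product, so polynomials in [t] suffice for associativity. *)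
Lemma eq_fps_bilin (K : fieldType) (A : algType K) (mu : nat -> A -> A -> A)
    (a a' c c' : nat -> A) n :
  (forall i, (i <= n)%N -> a i = a' i) ->
  (forall i, (i <= n)%N -> c i = c' i) ->
  forall k, (k <= n)%N -> fps_bilin mu a c k = fps_bilin mu a' c' k.
Proof.
move=> aa' cc' k lekn; apply: eq_bigr => i _; apply: eq_bigr => j _.
have leik : (i <= k)%N by rewrite -ltnS.
have lejk : (j <= k)%N.
  by apply: leq_trans (leq_subr i k); rewrite -ltnS.
by rewrite (aa' _ (leq_trans leik lekn)) (cc' _ (leq_trans lejk lekn)).
Qed.

Section Deformation.
Variable K : fieldType.
Local Notation U := (uea K).
Local Notation Ut := {mpoly {poly K}[6]}.
Local Notation "u %:S" := (series_const u) (at level 2, format "u %:S").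
Local Notation coef := (@series_coef K).
Local Notation mul := (@hecke_mul {poly K} 'X).
Local Notation mu := (@uea_deformation K).
Implicit Types (u : U) (v w : Ut).

Lemma series_const_linear a u u' : (a *: u + u')%:S = a%:P *: u%:S + u'%:S.
Proof. by rewrite /series_const raddfD /= map_mpolyZ. Qed.

Lemma series_coefE n v m : (coef n v : {mpoly K[6]})@_m = (v@_m)`_n.
Proof. by rewrite mcoeff_map_mpoly. Qed.

Fact series_coef_zmod_morphism n : zmod_morphism (coef n).
Proof. by move=> v w; apply: raddfB. Qed.
HB.instance Definition _ n :=
  GRing.isZmodMorphism.Build Ut U (coef n) (series_coef_zmod_morphism n).

Lemma series_coefZ n a v : coef n (a%:P *: v) = a *: coef n v.
Proof.
by apply/mpolyP => m; rewrite series_coefE !mcoeffZ coefCM series_coefE.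
Qed.

Lemma series_coef_mulX n r v :
  coef n ('X^r *: v) = if (r <= n)%N then coef (n - r) v else 0.
Proof.
apply/mpolyP => m; rewrite series_coefE mcoeffZ coefXnM ltnNge.
by case: leqP; rewrite ?mcoeff0 // series_coefE.
Qed.

Lemma series_coef_const n u : coef n u%:S = u *+ (n == 0%N).
Proof.
apply/mpolyP => m; rewrite series_coefE mcoeff_map_mpoly coefC.
by case: eqP; rewrite ?mcoeff0.
Qed.

Lemma series_coef_mulX_const n r u : coef n ('X^r *: u%:S) = u *+ (n == r).
Proof.
rewrite series_coef_mulX series_coef_const subn_eq0 eqn_leq andbC.
by case: leqP.
Qed.

Lemma series_ind (Pr : Ut -> Prop) :
  Pr 0 -> (forall v w, Pr v -> Pr w -> Pr (v + w)) ->
  (forall r u, Pr ('X^r *: u%:S)) -> forall v, Pr v.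
Proof.
move=> P0 PD PX; elim/mpolyind => // a m v _ _ Pv; apply: (PD) => //.
rewrite -[a]coefK poly_def scaler_suml; apply: (big_ind Pr) => // r _.
have -> : (a`_r *: 'X^r) *: 'X_[m] = 'X^r *: (a`_r *: 'X_[m] : U)%:S.
  by rewrite /series_const map_mpolyZ map_mpolyX scalerA -mul_polyC mulrC.
exact: PX.
Qed.

Fact uea_deformation_linearl n u : linear (mu n ^~ u).
Proof.
move=> a u1 u2; rewrite /uea_deformation series_const_linear hecke_mulDl.
by rewrite hecke_mulZl raddfD /= series_coefZ.
Qed.

Fact uea_deformation_linearr n u : linear (mu n u).
Proof.
move=> a u1 u2; rewrite /uea_deformation series_const_linear hecke_mulDr.
by rewrite hecke_mulZr raddfD /= series_coefZ.
Qed.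

Lemma uea_deformation0 u u' : mu 0%N u u' = u * u'.
Proof.
have -> : mu 0%N u u' = map_mpoly (coefp 0) (mul u%:S u'%:S) by [].
have -> : u * u' = hecke_mul (coefp 0 'X) u u' :> U.
  by rewrite /= coefX.
rewrite map_mpoly_hecke_mul -![map_mpoly _ _%:S]/(coef 0 _).
by rewrite !series_coef_const.
Qed.

Lemma uea_deformationDl n u1 u2 u : mu n (u1 + u2) u = mu n u1 u + mu n u2 u.
Proof. by have := uea_deformation_linearl n u 1 u1 u2; rewrite !scale1r. Qed.

Lemma uea_deformationDr n u u1 u2 : mu n u (u1 + u2) = mu n u u1 + mu n u u2.
Proof. by have := uea_deformation_linearr n u 1 u1 u2; rewrite !scale1r. Qed.

Lemma uea_deformation0l n u : mu n 0 u = 0.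
Proof. by apply: (addrI (mu n 0 u)); rewrite -uea_deformationDl !addr0. Qed.

Lemma uea_deformation0r n u : mu n u 0 = 0.
Proof. by apply: (addrI (mu n u 0)); rewrite -uea_deformationDr !addr0. Qed.

Lemma series_coef_mul_monomials n r s u u' :
  coef n (mul ('X^r *: u%:S) ('X^s *: u'%:S)) =
  fps_bilin mu (coef^~ ('X^r *: u%:S)) (coef^~ ('X^s *: u'%:S)) n.
Proof.
pose F i j := mu (n - i - j) (coef i ('X^r *: u%:S)) (coef j ('X^s *: u'%:S)).
rewrite /fps_bilin.
rewrite (@sum_ord_delta _ _ r (fun i => \sum_(j < (n - i).+1) F i j)) => [|i].
  rewrite (@sum_ord_delta _ _ s (F r)) => [|j /negPf ne_js]; last first.
    by rewrite /F (series_coef_mulX_const j) ne_js uea_deformation0r.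
  rewrite /F !series_coef_mulX_const !eqxx hecke_mulZl hecke_mulZr.
  by rewrite !series_coef_mulX !ltnS; do 2?case: leqP.
move=> /negPf ne_ir; rewrite big1 // => j _.
by rewrite /F series_coef_mulX_const ne_ir uea_deformation0l.
Qed.

Lemma series_coef_mul n v w :
  coef n (mul v w) = fps_bilin mu (coef^~ v) (coef^~ w) n.
Proof.
elim/series_ind: v => [|v v' IHv IHv'|r u].
- rewrite [mul 0 w]raddf0 raddf0 /fps_bilin big1 // => i _.
  by rewrite big1 // => j _; rewrite raddf0 uea_deformation0l.
- rewrite hecke_mulDl raddfD /= IHv IHv' -big_split; apply: eq_bigr => i _ /=.
  rewrite -big_split; apply: eq_bigr => j _ /=.
  by rewrite -uea_deformationDl -raddfD.
elim/series_ind: w => [|w w' IHw IHw'|s u'].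
- rewrite !raddf0 /fps_bilin big1 // => i _; rewrite big1 // => j _.
  by rewrite [coef j 0]raddf0 uea_deformation0r.
- rewrite hecke_mulDr raddfD /= IHw IHw' -big_split; apply: eq_bigr => i _ /=.
  rewrite -big_split; apply: eq_bigr => j _ /=.
  by rewrite -uea_deformationDr -raddfD.
- exact: series_coef_mul_monomials.
Qed.

Definition series_trunc (n : nat) (a : nat -> U) : Ut :=
  \sum_(i < n.+1) 'X^i *: (a i)%:S.

Lemma series_coef_trunc n a i : (i <= n)%N -> coef i (series_trunc n a) = a i.
Proof.
move=> lein; rewrite raddf_sum /=.
pose F j := coef i ('X^j *: (a j)%:S).
rewrite (@sum_ord_delta _ _ i F) /F => [|j ne_ji].
  by rewrite ltnS lein series_coef_mulX_const eqxx.
by rewrite series_coef_mulX_const eq_sym (negPf ne_ji).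
Qed.

Lemma formal_deformation_uea : formal_deformation mu.
Proof.
split; [exact: uea_deformation_linearl | exact: uea_deformation_linearr
  | exact: uea_deformation0 | move=> a b c n].
have coef_trunc d i : (i <= n)%N -> d i = coef i (series_trunc n d).
  by move=> lein; rewrite series_coef_trunc.
have coef_mul d d' i : (i <= n)%N ->
    fps_bilin mu d d' i = coef i (mul (series_trunc n d) (series_trunc n d')).
  by rewrite series_coef_mul; apply: eq_fps_bilin; apply: coef_trunc.
rewrite (eq_fps_bilin mu (coef_mul a b) (coef_trunc c) (leqnn n)).
rewrite (eq_fps_bilin mu (coef_trunc a) (coef_mul b c) (leqnn n)).
by rewrite -!series_coef_mul hecke_mulA.
Qed.

End Deformation.

(** * Non-triviality of the deformation *)

Lemma trivial_deformation_infinitesimal (K : fieldType) (A : algType K)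
    (mu : nat -> A -> A -> A) :
  formal_deformation mu -> trivial_deformation mu ->
  exists phi : {linear A -> A},
    forall a b, phi (a * b) + mu 1%N a b = a * phi b + phi a * b.
Proof.
move=> [mul mur mu0 _] [phi [phi0 triv]]; exists (phi 1%N) => a b.
have mu0l r u : mu r 0 u = 0.
  by have := mul r u (-1) 0 0; rewrite scaler0 addr0 scaleN1r addNr.
have mu0r r u : mu r u 0 = 0.
  by have := mur r u (-1) 0 0; rewrite scaler0 addr0 scaleN1r addNr.
pose const (c : A) (n : nat) : A := if n is 0%N then c else 0.
have := triv (const a) (const b) 1%N.
rewrite /fps_lin /fps_bilin /fps_mul !big_ord_recl !big_ord0 /=.
rewrite ?(big_ord_recl, big_ord0) /=.
by rewrite !phi0 !mu0l !mu0r !mu0 !addr0.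
Qed.

Definition ordered_casimir (A : pzRingType) (x : 'I_6 -> A) : A :=
  x ih * x ih + x ih *+ 2 + (x if_ * x ie) *+ 4.

Section AffineRepresentation.
Variable K : fieldType.
Local Notation g := (sl2n3 K).
Local Notation b := (basisg K).
Local Notation mat := 'M[K]_(1 + 2).

Definition sl2_mx (x : g) : 'M[K]_2 := \matrix_(i, j)
  nth 0 (nth [::] [:: [:: coordg ih x; coordg ie x];
                      [:: coordg if_ x; - coordg ih x]] i) j.

Definition qp_col (x : g) : 'cV[K]_2 :=
  \col_i nth 0 [:: coordg iq x; coordg ip x] i.

(* The affine representation on [K + K^2]: [n3] acts through its quotient
   [K^2 = <q, p>] by translations and [sl2] linearly. *)
Definition affine (x : g) : mat := block_mx 0 0 (qp_col x) (sl2_mx x).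

Lemma ord2P (Pr : 'I_2 -> Prop) : Pr 0 -> Pr 1 -> forall i, Pr i.
Proof.
move=> P0 P1; case=> [[|[|//]]] lti.
- by rewrite (_ : Ordinal lti = 0) //; exact/val_inj.
- by rewrite (_ : Ordinal lti = 1) //; exact/val_inj.
Qed.

Fact affine_linear : linear affine.
Proof.
move=> a x y; rewrite scale_block_mx add_block_mx !scaler0 !addr0.
congr block_mx; apply/matrixP => i j; rewrite !mxE.
  by elim/ord2P: i; rewrite /= linearP.
by elim/ord2P: i; elim/ord2P: j; rewrite /= linearP //=; ring.
Qed.
HB.instance Definition _ :=
  GRing.isLinear.Build K g mat _ affine affine_linear.

Lemma block_mx_ringE (a a' : 'M[K]_1) (r r' : 'M[K]_(1, 2))
    (c c' : 'M[K]_(2, 1)) (d d' : 'M[K]_2)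
    (x := block_mx a r c d : mat) (y := block_mx a' r' c' d' : mat) :
  (x + y = block_mx (a + a') (r + r') (c + c') (d + d')) *
  (x - y = block_mx (a - a') (r - r') (c - c') (d - d')) *
  (x * y = block_mx (a *m a' + r *m c') (a *m r' + r *m d')
                    (c *m a' + d *m c') (c *m r' + d *m d')).
Proof.
do !split; first exact: add_block_mx; last exact: mulmx_block.
by rewrite /y -[RHS]add_block_mx -opp_block_mx.
Qed.

Lemma sl2_mx_lie x y :
  sl2_mx (lie x y) = sl2_mx x *m sl2_mx y - sl2_mx y *m sl2_mx x.
Proof.
apply/matrixP => i j; rewrite !(mxE, big_ord_recl, big_ord0).
by elim/ord2P: i; elim/ord2P: j; rewrite /= /lie /= !coordgE; ring.
Qed.

Lemma qp_col_lie x y :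
  qp_col (lie x y) = sl2_mx x *m qp_col y - sl2_mx y *m qp_col x.
Proof.
apply/matrixP => i j; rewrite !(mxE, big_ord_recl, big_ord0).
by elim/ord2P: i; rewrite /= /lie /= !coordgE; ring.
Qed.

Lemma affine_lie : lie_to_assoc affine.
Proof.
move=> x y; rewrite /affine sl2_mx_lie qp_col_lie !block_mx_ringE.
by rewrite !(mul0mx, mulmx0, add0r, oppr0).
Qed.

Definition affine_rep : {lrmorphism uea K -> mat} := uea_lift affine_lie.

Lemma affine_rep_incl x : affine_rep (uea_incl x) = affine x.
Proof. exact: uea_lift_incl. Qed.

Let affine_repD u v : affine_rep (u + v) = affine_rep u + affine_rep v :=
  rmorphD affine_rep u v.
Let affine_repB u v : affine_rep (u - v) = affine_rep u - affine_rep v :=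
  rmorphB affine_rep u v.
Let affine_repM u v : affine_rep (u * v) = affine_rep u * affine_rep v :=
  rmorphM affine_rep u v.
Let affine_repMn u n : affine_rep (u *+ n) = affine_rep u *+ n :=
  rmorphMn affine_rep n u.
Let affine_repE := (affine_repB, affine_repD, affine_repM, affine_repMn).

Definition block_lower (x : mat) : Prop :=
  exists a c d, x = block_mx a 0 c d.

Lemma block_lower_affine_rep u : block_lower (affine_rep u).
Proof.
elim/uea_ind: u => [k u v [a [c [d uE]]] [a' [c' [d' vE]]]||i u [a [c [d uE]]]].
- have -> : affine_rep (k *: u + v) = k *: affine_rep u + affine_rep v.
    exact: linearP.
  rewrite uE vE; exists (k *: a + a'), (k *: c + c'), (k *: d + d').
  have -> : k *: (block_mx a 0 c d : mat) =
      block_mx (k *: a) (k *: 0) (k *: c) (k *: d) by exact: scale_block_mx.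
  by rewrite block_mx_ringE scaler0 addr0.
- by exists 1%:M, 0, 1%:M; rewrite rmorph1; apply: scalar_mx_block.
rewrite affine_repM affine_rep_incl uE.
by rewrite block_mx_ringE !(mul0mx, mulmx0) !addr0; do 3!eexists.
Qed.

Lemma affine_casimir :
  ordered_casimir (fun i => affine (b i)) = block_mx 0 0 0 3%:R%:M.
Proof.
rewrite /ordered_casimir !mulrS !mulr0n !addr0 !block_mx_ringE.
rewrite !(mul0mx, mulmx0, addr0).
congr block_mx; apply/matrixP => i j; rewrite !(mxE, big_ord_recl, big_ord0).
  by elim/ord2P: i; rewrite /= !coordg_basis /=; ring.
by elim/ord2P: i; elim/ord2P: j; rewrite /= !coordg_basis /=; ring.
Qed.

Lemma sl2_mx_n3 (i : 'I_6) : (2 < i)%N -> sl2_mx (b i) = 0.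
Proof.
move=> lti; apply/matrixP => j k; rewrite !mxE.
by elim/ord6P: i lti => // _; elim/ord2P: j; elim/ord2P: k;
  rewrite /= !coordg_basis /= ?oppr0.
Qed.

Lemma affine_z : affine (b iz) = 0.
Proof.
have qp_col_z : qp_col (b iz) = 0.
  by apply/matrixP => i j; rewrite !mxE; elim/ord2P: i; rewrite /= coordg_basis.
by rewrite /affine sl2_mx_n3 // qp_col_z; apply: block_mx0.
Qed.

Lemma affine_obstruction (q := affine (b iq)) (p := affine (b ip))
    (Z Q P : mat) :
  block_lower Z -> block_lower Q -> block_lower P ->
  Z + block_mx 0 0 0 3%:R%:M = q * P + Q * p - (p * Q + P * q) ->
  q * Z = Z * q -> 3%:R = 0 :> K.
Proof.
move=> [a [c [d ->]]] [a1 [c1 [d1 ->]]] [a2 [c2 [d2 ->]]].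
rewrite /q /p /affine !sl2_mx_n3 // !block_mx_ringE.
rewrite !(mul0mx, mulmx0, addr0, add0r, oppr0).
case/eq_block_mx => a0 _ _ /eqP; rewrite addr_eq0 => /eqP ->.
case/eq_block_mx => _ _ + _; rewrite a0 mulmx0 mulNmx mul_scalar_mx.
move/matrixP/(_ 0 0)/esym/eqP; rewrite !mxE /= coordg_basis mulr1 oppr_eq0.
by move/eqP.
Qed.

Local Notation mu := (@uea_deformation K).
Local Notation reg := (regular_op ('X : {poly K})).
Local Notation gen i := (uea_incl (b i)).

Lemma uea_deformation_gen n i j :
  mu n (gen i) (gen j) = series_coef n (reg i (reg j 1)).
Proof.
rewrite /uea_deformation /series_const !uea_incl_basis !map_mpolyX.
by rewrite hecke_mulX regular_op_1.
Qed.

Lemma series_coef0_op i v :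
  series_coef 0 (reg i v) = gen i * series_coef 0 v.
Proof.
rewrite uea_gen_mul -[LHS]/(map_mpoly (coefp 0) _) map_mpoly_regular_op.
by congr (regular_op _ i _); rewrite /= coefX.
Qed.

Lemma uea_deformation_zq : mu 1 (gen iz) (gen iq) = mu 1 (gen iq) (gen iz).
Proof. by rewrite !uea_deformation_gen (op_z (regular_module _)). Qed.

Lemma uea_deformation_qp : mu 1 (gen iq) (gen ip) =
  mu 1 (gen ip) (gen iq)
  + ordered_casimir (fun i => gen i).
Proof.
have coef1 : series_coef 0 1 = 1 :> uea K.
  exact: rmorph1 (map_mpoly (coefp 0)).
have coef_z : series_coef 1 (reg iz 1) = 0 :> uea K.
  rewrite regular_op_1 -(map_mpolyX (@polyC K)).
  by rewrite -[map_mpoly _ _]/(series_const _) series_coef_const.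
rewrite !uea_deformation_gen (op_q_p (regular_module _)) -['X]expr1.
have coefD n v w : series_coef n (v + w) = series_coef n v + series_coef n w
  by exact: raddfD.
have coefMn n v k : series_coef n (v *+ k) = series_coef n v *+ k
  by exact: raddfMn.
rewrite 2!coefD coef_z addr0 series_coef_mulX expr1 /casimir_op.
rewrite 2!coefD !coefMn.
by rewrite !series_coef0_op coef1 !mulr1.
Qed.

Local Notation q := (gen iq).
Local Notation p := (gen ip).
Local Notation z := (gen iz).

Lemma uea_comm_basis i j :
  gen i * gen j - gen j * gen i = uea_incl (lie (b i) (b j)).
Proof. by rewrite uea_incl_lie. Qed.

Section Trivialization.
Variable phi : {linear uea K -> uea K}.
Hypothesis phiM : forall u v, phi (u * v) + mu 1 u v = u * phi v + phi u * v.

Lemma trivialization_casimir :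
  phi z + ordered_casimir (fun i => gen i) =
  q * phi p + phi q * p - (p * phi q + phi p * q).
Proof.
have zE : z = q * p - p * q by rewrite uea_comm_basis lie_basis.
rewrite -!phiM uea_deformation_qp zE raddfB opprD [in RHS]addrACA.
by rewrite [mu 1 p q + _]addrC addrK.
Qed.

Lemma trivialization_z : q * phi z + phi q * z = z * phi q + phi z * q.
Proof.
have zq : z * q = q * z.
  by apply/eqP; rewrite -subr_eq0 uea_comm_basis lie_z linear0.
by rewrite -!phiM zq uea_deformation_zq.
Qed.

End Trivialization.

Lemma uea_deformation_not_trivial : 3%:R != 0 :> K -> ~ trivial_deformation mu.
Proof.
move=> /eqP nz3 triv; apply: nz3.
have [phi phiM] :=
  trivial_deformation_infinitesimal (formal_deformation_uea K) triv.
apply: (@affine_obstruction (affine_rep (phi z)) (affine_rep (phi q))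
  (affine_rep (phi p))); try exact: block_lower_affine_rep.
  have := congr1 affine_rep (trivialization_casimir phiM).
  rewrite /ordered_casimir !affine_repE !affine_rep_incl => <-.
  by rewrite -affine_casimir.
have := congr1 affine_rep (trivialization_z phiM).
by rewrite !affine_repE !affine_rep_incl affine_z mul0r mulr0 addr0 add0r.
Qed.

End AffineRepresentation.

(** * The cohomology class of [P] *)

Section PoissonBivector.
Variable K : fieldType.
Local Notation g := (sl2n3 K).
Local Notation Sg := {mpoly K[6]}.
Local Notation b := (basisg K).
Implicit Types (x y w : g) (F G : Sg) (u v : n3 K).

Let mpolyCE := (@mpolyCD 6 K, @mpolyCN 6 K, @mpolyCM 6 K, @mpolyC1 6 K,
  @mpolyC0 6 K).

Lemma coordg_sl2 x : x \in sl2 K ->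
  [/\ coordg ip x = 0, coordg iq x = 0 & coordg iz x = 0].
Proof.
rewrite /sl2 !span_cons span_nil addv0.
case/memv_addP => _ /vlineP[a1 ->] [_ /memv_addP[_ /vlineP[a2 ->]
  [_ /vlineP[a3 ->] ->]] ->].
by split; rewrite !(linearD, linearZ) /= !coordg_basis /=; ring.
Qed.

Lemma coordg_n3 u : [/\ coordg ih (n3_incl u) = 0,
  coordg ie (n3_incl u) = 0 & coordg if_ (n3_incl u) = 0].
Proof. by case/mem_n3P: (subvsP u). Qed.

Lemma sym_inclE x : sym_incl x = (coordg ih x)%:MP * 'X_ih
  + (coordg ie x)%:MP * 'X_ie + (coordg if_ x)%:MP * 'X_if_
  + (coordg ip x)%:MP * 'X_ip + (coordg iq x)%:MP * 'X_iq
  + (coordg iz x)%:MP * 'X_iz.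
Proof. by rewrite /sym_incl sum_ord6 -!mul_mpolyC. Qed.

Lemma mderiv_casimir i : (casimir K)^`M(i) = ('X_ih * (i == ih)%:R) *+ 2
  + 4%:R * ((i == ie)%:R * 'X_if_ + 'X_ie * (i == if_)%:R).
Proof.
rewrite /casimir expr2 -mulrA mderivD !mderivM !mderivXU.
by rewrite -mpolyC_nat mderivC; ring.
Qed.

Lemma sym_act_casimir x : sym_act x (casimir K) =
  (coordg iq x)%:MP * (- ('X_ih * 'X_iq) *+ 2 - ('X_ie * 'X_ip) *+ 4)
  + (coordg ip x)%:MP * (('X_ih * 'X_ip) *+ 2 - ('X_iq * 'X_if_) *+ 4).
Proof.
rewrite /sym_act sum_ord6 !mderiv_casimir /= !sym_inclE /lie /= !coordgE.
by rewrite !coordg_basis /= !mpolyCE; ring.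
Qed.

Lemma bivPE x y : bivP K x y =
  (coordg iq x * coordg ip y - coordg iq y * coordg ip x)%:MP * casimir K.
Proof. by rewrite /bivP mul_mpolyC. Qed.

Lemma sym_act_bivP w x y : sym_act w (bivP K x y) =
  (coordg iq x * coordg ip y - coordg iq y * coordg ip x)%:MP
  * sym_act w (casimir K).
Proof. by rewrite /bivP linearZ /= mul_mpolyC. Qed.

Lemma bivP_linearl y : linear (bivP K ^~ y).
Proof.
by move=> a x w; rewrite !bivPE -mul_mpolyC !linearP /= !mpolyCE; ring.
Qed.

Lemma bivP_linearr x : linear (bivP K x).
Proof.
by move=> a y w; rewrite !bivPE -mul_mpolyC !linearP /= !mpolyCE; ring.
Qed.

Lemma bivP_sl2_invariant : sl2_invariant (restr_n3 (bivP K)).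
Proof.
move=> x /coordg_sl2[xp xq _] u v.
rewrite /act_cochain2 /restr_n3 sym_act_bivP sym_act_casimir !ad_n3E !bivPE.
rewrite /lie /= !coordgE xp xq.
have [-> -> ->] := coordg_n3 u; have [-> -> ->] := coordg_n3 v.
by rewrite !mpolyCE; ring.
Qed.

Lemma biderivation_incl (B : g -> g -> Sg) F w : (forall x, linear (B x)) ->
  biderivation B F (sym_incl w) = \sum_i B (b i) w * F^`M(i).
Proof.
move=> Bl; apply: eq_bigr => i _.
rewrite (linear_coordgE w (Bl _)) mulr_suml; apply: eq_bigr => j _.
by rewrite mderiv_sym_incl -mul_mpolyC; ring.
Qed.

Lemma biderivation_bivP F w : biderivation (bivP K) F (sym_incl w) =
  casimir K * ((coordg ip w)%:MP * F^`M(iq) - (coordg iq w)%:MP * F^`M(ip)).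
Proof.
rewrite (biderivation_incl _ _ bivP_linearr) sum_ord6 !bivPE !coordg_basis /=.
by rewrite !mpolyCE; ring.
Qed.

Lemma biderivation_poisson0 F w :
  biderivation (poisson0 K) F (sym_incl w) = - sym_act w F.
Proof.
rewrite biderivation_incl => [|x a y z]; last first.
  by rewrite /poisson0 lie_linearr linearP.
rewrite /sym_act -sumrN; apply: eq_bigr => i _.
by rewrite /poisson0 lieN raddfN mulNr.
Qed.

Lemma schouten_bivP x y w : schouten2 (bivP K) (bivP K) x y w = 0.
Proof.
rewrite /schouten2 !biderivation_bivP /bivP !mderivZ !mderiv_casimir /=.
by rewrite -!mul_mpolyC; ring.
Qed.

Lemma schouten_poisson0_bivP x y w : schouten2 (poisson0 K) (bivP K) x y w = 0.
Proof.
rewrite /schouten2 !biderivation_bivP !biderivation_poisson0.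
rewrite !sym_act_bivP !sym_act_casimir /poisson0 !mderiv_sym_incl.
by rewrite /lie /= !coordgE !mpolyCE; ring.
Qed.

Lemma ce_cocycle2_bivP : ce_cocycle2 (sym_act_n3 K) (restr_n3 (bivP K)).
Proof.
split; first split.
- by move=> v a u w; rewrite /restr_n3 n3_incl_linear bivP_linearl.
- by move=> v a u w; rewrite /restr_n3 n3_incl_linear bivP_linearr.
- by move=> u; rewrite /restr_n3 bivPE subrr mpolyC0 mul0r.
move=> u v w; rewrite /ce_d2 /restr_n3 /sym_act_n3 !bracket_n3E.
rewrite !sym_act_bivP !sym_act_casimir !bivPE /lie /= !coordgE.
have [-> -> ->] := coordg_n3 u; have [-> -> ->] := coordg_n3 v.
have [-> -> ->] := coordg_n3 w.
by rewrite !mpolyCE; ring.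
Qed.

Lemma bivP_in_H2_invariants : in_H2_invariants (restr_n3 (bivP K)).
Proof.
split=> [|x x_sl2]; first exact: ce_cocycle2_bivP.
exists \0 => u v; rewrite bivP_sl2_invariant // /ce_d1 /=.
by rewrite /sym_act_n3 !raddf0 ?subr0 ?addr0.
Qed.

Lemma sym_act_q F : sym_act (b iq) F =
  'X_iz * F^`M(ip) - 'X_iq * F^`M(ih) - 'X_ip * F^`M(if_).
Proof.
rewrite /sym_act sum_ord6 !sym_inclE /lie /= !coordgE !coordg_basis /=.
by rewrite !mpolyCE; ring.
Qed.

Lemma sym_act_p F : sym_act (b ip) F =
  'X_ip * F^`M(ih) - 'X_iz * F^`M(iq) - 'X_iq * F^`M(ie).
Proof.
rewrite /sym_act sum_ord6 !sym_inclE /lie /= !coordgE !coordg_basis /=.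
by rewrite !mpolyCE; ring.
Qed.

Lemma sym_act_z F : sym_act (b iz) F = 0.
Proof.
by rewrite /sym_act big1 // => i _; rewrite lie_z linear0 mul0r.
Qed.

Definition h_dual (i : 'I_6) : K := (i == ih)%:R.

Let mevalE := (@mevalB 6 K h_dual, @mevalD 6 K h_dual, @mevalM 6 K h_dual,
  @mevalN 6 K h_dual, @mevalXU 6 K h_dual, @mevalMn 6 K h_dual).

Lemma meval_mderiv_sym_act_q F :
  ((sym_act (b iq) F)^`M(ih)).@[h_dual] = 0 /\
  ((sym_act (b iq) F)^`M(iq)).@[h_dual] = - (F^`M(ih)).@[h_dual].
Proof.
rewrite sym_act_q !(mderivB, mderiv_mulX) !mevalE /h_dual /=.
by split; ring.
Qed.

Lemma meval_mderiv_sym_act_p F : ((sym_act (b ip) F)^`M(ih)).@[h_dual] = 0.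
Proof.
by rewrite sym_act_p !(mderivB, mderiv_mulX) !mevalE /h_dual /=; ring.
Qed.

Lemma meval_mderiv_casimir : ((casimir K)^`M(ih)).@[h_dual] = 2%:R.
Proof. by rewrite mderiv_casimir !mulr0 !mevalE /h_dual /=; ring. Qed.

Definition n3_basis (i : 'I_6) : n3 K := vsproj (n3_vspace K) (b i).

Lemma n3_basisE (i : 'I_6) : (2 < i)%N -> n3_incl (n3_basis i) = b i.
Proof.
move=> lti; rewrite /n3_incl vsprojK //; apply/mem_n3P.
by elim/ord6P: i lti => // _; rewrite !coordg_basis.
Qed.

Lemma bivP_not_coboundary : 2%:R != 0 :> K ->
  ~ ce_cohomologous2 (sym_act_n3 K) (restr_n3 (bivP K)) (fun _ _ => 0).
Proof.
move=> /eqP nz2 [phi phiE]; apply: nz2.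
set p := n3_basis ip; set q := n3_basis iq; set z := n3_basis iz.
have [pE qE zE] : [/\ n3_incl p = b ip, n3_incl q = b iq & n3_incl z = b iz].
  by rewrite !n3_basisE.
have qp : lie q p = z.
  by apply: n3_incl_inj; rewrite bracket_n3E pE qE zE lie_basis.
have zq : lie z q = 0.
  by apply: n3_incl_inj; rewrite bracket_n3E zE qE lie_z n3_incl0.
have casimirE : casimir K =
    sym_act (b iq) (phi p) - sym_act (b ip) (phi q) - phi z.
  have := phiE q p; rewrite subr0 /ce_d1 /sym_act_n3 /restr_n3 bivPE qp pE qE.
  by rewrite !coordg_basis /= mul0r subr0 mulr1 mpolyC1 mul1r.
have q_phi_z : sym_act (b iq) (phi z) = 0.
  have := phiE z q; rewrite subr0 /ce_d1 /sym_act_n3 /restr_n3 bivPE zq zE qE.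
  rewrite sym_act_z raddf0 !coordg_basis /= !mul0r mulr0 subrr mpolyC0 mul0r.
  by rewrite !subr0 sub0r => /esym/eqP; rewrite oppr_eq0 => /eqP.
have [_ dphi_z] := meval_mderiv_sym_act_q (phi z).
have [dq _] := meval_mderiv_sym_act_q (phi p).
have := meval_mderiv_casimir; rewrite casimirE !mderivB !mevalB.
rewrite dq meval_mderiv_sym_act_p -dphi_z q_phi_z mderiv0 meval0.
by rewrite !subr0 addr0 => ->.
Qed.

End PoissonBivector.

Local Open Scope complex_scope.

Theorem proposition6p2 (R : realType) :
  [/\ sl2_invariant (restr_n3 (bivP R[i])),
      (forall x y w : sl2n3 R[i],
         schouten2 (bivP R[i]) (bivP R[i]) x y w = 0),
      (forall x y w : sl2n3 R[i],
         schouten2 (poisson0 R[i]) (bivP R[i]) x y w = 0),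
      (in_H2_invariants (restr_n3 (bivP R[i])) /\
       ~ ce_cohomologous2 (sym_act_n3 R[i]) (restr_n3 (bivP R[i]))
           (fun _ _ => 0))
    & ~ strongly_rigid (sl2n3 R[i])].
Proof.
split.
- exact: bivP_sl2_invariant.
- exact: schouten_bivP.
- exact: schouten_poisson0_bivP.
- split; first exact: bivP_in_H2_invariants.
  by apply: bivP_not_coboundary; rewrite Num.Theory.pnatr_eq0.
- move=> rigid_g; apply: (@uea_deformation_not_trivial R[i]).
    by rewrite Num.Theory.pnatr_eq0.
  apply: rigid_g (universal_enveloping_uea R[i]) _ _.
  exact: formal_deformation_uea.
Qed.
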